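(* Let $A$ be a group and let $C$ be a malnormal abelian subgroup of $A$. If $A$ is flexible, then $A\ast_C$ and $A\ast_C\bar A$ are flexible. If $A$ is liftable-flexible, then $A\ast_C$ and $A\ast_C\bar A$ are liftable-flexible.
   Context: For a group $L$, $T_L$ denotes the set of torsion elements of $L$ (including the identity). A projective representation of $L$ is a homomorphism $\rho\colon L\to \mathrm{PSL}_2(\mathbb{R})$; it is parabolic-free if $\rho(L)$ contains no nontrivial parabolic element, and indiscrete if $\rho(L)$ is not a discrete subgroup of $\mathrm{PSL}_2(\mathbb{R})$. It is liftable if it factors as $L\to \widetilde{\mathrm{PSL}}_2(\mathbb{R})\to\mathrm{PSL}_2(\mathbb{R})$ through the universal covering map. A set $\Lambda\subseteq\mathrm{Hom}(L,\mathrm{PSL}_2(\mathbb{R}))$ is tracially disjoint if $\mathrm{tr}^2\circ\rho(L\setminus T_L)\cap\mathrm{tr}^2\circ\lambda(L\setminus T_L)=\varnothing$ for every pair of distinct $\rho,\lambda\in\Lambda$, where $\mathrm{tr}^2$ is the square of the trace. A finitely generated group $L$ is flexible if there exists an uncountable, tracially disjoint set $\Lambda$ of indiscrete faithful parabolic-free projective representations of $L$; it is liftable-flexible if moreover $\Lambda$ can be chosen so that each representation in $\Lambda$ is liftable. A subgroup $C\le A$ is malnormal if $g^{-1}Cg\cap C=\{1\}$ for all $g\in A\setminus C$. $A\ast_C\bar A$ denotes the amalgamated product of two copies of $A$ along $\mathrm{Id}_C$ (the double of $A$ along $C$), and $A\ast_C:=A\ast_C(C\times\mathbb{Z})$, i.e.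 the HNN extension of $A$ along $\mathrm{Id}\colon C\to C$. *)

(* Defs.v *)
From HB Require Import structures.
From mathcomp Require Import all_boot all_order all_algebra.
From mathcomp Require Import generic_quotient.
From mathcomp Require Import all_classical all_reals topology normedtype.
Import numFieldNormedType.Exports.

Set Implicit Arguments.
Unset Strict Implicit.
Unset Printing Implicit Defensive.

Import Order.TTheory GRing.Theory Num.Theory.

Local Open Scope classical_set_scope.
Local Open Scope group_scope.
Local Open Scope quotient_scope.

Section SpecialLinear.
Context (R : realType).

Record SL2 := mkSL2 { SL2_mx : 'M[R]_2; _ : (\det SL2_mx == 1)%R }.

HB.instance Definition _ := [isSub for SL2_mx].
HB.instance Definition _ := [Choice of SL2 by <:].
HB.instance Definition _ := Topological.copy SL2 (initial_topology SL2_mx).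

Implicit Types M N P : SL2.

Lemma SL2_det M : (\det (SL2_mx M) = 1)%R.
Proof. by case: M => M /= /eqP. Qed.

Fact SL2_one_proof : (\det (1%:M : 'M[R]_2) == 1)%R.
Proof. by rewrite det1. Qed.
Fact SL2_mul_proof M N : (\det (SL2_mx M *m SL2_mx N) == 1)%R.
Proof. by rewrite det_mulmx !SL2_det mulr1. Qed.
Fact SL2_inv_proof M : (\det (invmx (SL2_mx M)) == 1)%R.
Proof. by rewrite det_inv SL2_det invr1. Qed.
Fact SL2_opp_proof M : (\det (- SL2_mx M) == 1)%R.
Proof. by rewrite -scaleN1r detZ SL2_det mulr1 expr2 mulrNN mulr1. Qed.

Definition SL2_one := mkSL2 SL2_one_proof.
Definition SL2_mul M N := mkSL2 (SL2_mul_proof M N).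
Definition SL2_inv M := mkSL2 (SL2_inv_proof M).
Definition SL2_opp M := mkSL2 (SL2_opp_proof M).

Lemma SL2_unit M : SL2_mx M \in unitmx.
Proof. by rewrite unitmxE SL2_det unitr1. Qed.

Fact SL2_mulA : associative SL2_mul.
Proof. by move=> M N P; apply: val_inj; rewrite /= mulmxA. Qed.
Fact SL2_mul1 : left_id SL2_one SL2_mul.
Proof. by move=> M; apply: val_inj; rewrite /= mul1mx. Qed.
Fact SL2_mulr1 : right_id SL2_one SL2_mul.
Proof. by move=> M; apply: val_inj; rewrite /= mulmx1. Qed.
Fact SL2_mulV : left_inverse SL2_one SL2_inv SL2_mul.
Proof. by move=> M; apply: val_inj; rewrite /= mulVmx// SL2_unit. Qed.
Fact SL2_mulrV : right_inverse SL2_one SL2_inv SL2_mul.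
Proof. by move=> M; apply: val_inj; rewrite /= mulmxV// SL2_unit. Qed.

HB.instance Definition _ :=
  isGroup.Build SL2 SL2_mulA SL2_mul1 SL2_mulr1 SL2_mulV SL2_mulrV.

Lemma SL2_oppK : involutive SL2_opp.
Proof. by move=> M; apply: val_inj; rewrite /= opprK. Qed.
Lemma SL2_mulNl M N : SL2_opp M * N = SL2_opp (M * N).
Proof. by apply: val_inj; rewrite /= mulNmx. Qed.
Lemma SL2_mulNr M N : M * SL2_opp N = SL2_opp (M * N).
Proof. by apply: val_inj; rewrite /= mulmxN. Qed.
Lemma SL2_invN M : (SL2_opp M)^-1 = SL2_opp M^-1.
Proof. by apply: (mulgI (SL2_opp M)); rewrite mulgV SL2_mulNl SL2_mulNr SL2_oppK mulgV. Qed.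

Definition pm_eq M N := (M == N) || (M == SL2_opp N).

Fact pm_eq_refl : reflexive pm_eq.
Proof. by move=> M; rewrite /pm_eq eqxx. Qed.
Fact pm_eq_sym : symmetric pm_eq.
Proof.
move=> M N; rewrite /pm_eq eq_sym; congr (_ || _).
by apply/eqP/eqP => ->; rewrite SL2_oppK.
Qed.
Fact pm_eq_trans : transitive pm_eq.
Proof.
by move=> N M P /orP[]/eqP -> // /orP[]/eqP->; rewrite /pm_eq ?SL2_oppK ?eqxx ?orbT.
Qed.
Canonical pm_eq_equiv := EquivRel pm_eq pm_eq_refl pm_eq_sym pm_eq_trans.

Definition PSL2 : Type := quotient_topology {eq_quot pm_eq}.
HB.instance Definition _ := Topological.on PSL2.
HB.instance Definition _ := Quotient.on PSL2.

Implicit Types p q r : PSL2.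

Lemma PSL2_eqP M N : \pi_PSL2 M = \pi_PSL2 N <-> M = N \/ M = SL2_opp N.
Proof.
have E : reflect (\pi_PSL2 M = \pi_PSL2 N) (pm_eq M N).
  exact: (eqquotP {eq_quot pm_eq} M N).
by split=> [/E/orP[]/eqP|]; [left|right|case=> MN; apply/E/orP; rewrite MN eqxx; [left|right]].
Qed.

Lemma PSL2_piN M : \pi_PSL2 (SL2_opp M) = \pi_PSL2 M.
Proof. by apply/PSL2_eqP; right. Qed.

Lemma PSL2_repr M : repr (\pi_PSL2 M) = M \/ repr (\pi_PSL2 M) = SL2_opp M.
Proof. by apply/PSL2_eqP; rewrite reprK. Qed.

Lemma PSL2P p : exists M, p = \pi_PSL2 M.
Proof. by exists (repr p); rewrite reprK. Qed.

Definition PSL2_one : PSL2 := \pi_PSL2 1.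
Definition PSL2_mul p q : PSL2 := \pi_PSL2 (repr p * repr q).
Definition PSL2_inv p : PSL2 := \pi_PSL2 (repr p)^-1.

Lemma PSL2_mul_pi M N : PSL2_mul (\pi_PSL2 M) (\pi_PSL2 N) = \pi_PSL2 (M * N).
Proof.
rewrite /PSL2_mul; case: (PSL2_repr M) => ->; case: (PSL2_repr N) => ->;
by rewrite ?SL2_mulNl ?SL2_mulNr ?PSL2_piN.
Qed.

Lemma PSL2_inv_pi M : PSL2_inv (\pi_PSL2 M) = \pi_PSL2 M^-1.
Proof.
by rewrite /PSL2_inv; case: (PSL2_repr M) => ->; rewrite ?SL2_invN ?PSL2_piN.
Qed.

Fact PSL2_mulA : associative PSL2_mul.
Proof.
move=> p q r; have [[[M ->] [N ->]] [P ->]] := (PSL2P p, PSL2P q, PSL2P r).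
by rewrite !PSL2_mul_pi mulgA.
Qed.
Fact PSL2_mul1 : left_id PSL2_one PSL2_mul.
Proof. by move=> p; have [M ->] := PSL2P p; rewrite PSL2_mul_pi mul1g. Qed.
Fact PSL2_mulr1 : right_id PSL2_one PSL2_mul.
Proof. by move=> p; have [M ->] := PSL2P p; rewrite PSL2_mul_pi mulg1. Qed.
Fact PSL2_mulV : left_inverse PSL2_one PSL2_inv PSL2_mul.
Proof.
by move=> p; have [M ->] := PSL2P p; rewrite PSL2_inv_pi PSL2_mul_pi mulVg.
Qed.
Fact PSL2_mulrV : right_inverse PSL2_one PSL2_inv PSL2_mul.
Proof.
by move=> p; have [M ->] := PSL2P p; rewrite PSL2_inv_pi PSL2_mul_pi mulgV.
Qed.

HB.instance Definition _ :=
  isGroup.Build PSL2 PSL2_mulA PSL2_mul1 PSL2_mulr1 PSL2_mulV PSL2_mulrV.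

Definition tr2 p : R := ((\tr (SL2_mx (repr p))) ^+ 2)%R.

Lemma tr2_pi M : tr2 (\pi_PSL2 M) = ((\tr (SL2_mx M)) ^+ 2)%R.
Proof.
rewrite /tr2; case: (PSL2_repr M) => -> //.
by rewrite /= raddfN sqrrN.
Qed.

Lemma continuous_mx (X : topologicalType) m n (f : X -> 'M[R]_(m, n)) :
  (forall i j, continuous (fun x => f x i j)) -> continuous f.
Proof.
move=> fc x A [P xP PA]; rewrite nbhs_simpl/=.
have : \forall y \near x, forall i j, P i j (f y i j).
  apply: filter_forall => i; apply: filter_forall => j.
  exact: (fc i j x _ (xP i j)).
by apply: filterS => y fy; apply: PA.
Qed.

Lemma SL2_val_continuous : continuous (fun M => SL2_mx M : 'M[R]_2).
Proof. exact: initial_continuous. Qed.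

Lemma continuous_SL2 (X : topologicalType) (f : X -> SL2) :
  continuous (fun x => SL2_mx (f x) : 'M[R]_2) -> continuous f.
Proof. by move=> fc; apply: continuous_comp_initial. Qed.

Lemma SL2_coord_continuous i j : continuous (fun M => SL2_mx M i j : R).
Proof.
move=> M; apply: (@continuous_comp _ _ _ (fun M => SL2_mx M : 'M[R]_2)
  (fun M : 'M[R]_2 => M i j)); first exact: SL2_val_continuous.
exact: coord_continuous.
Qed.

Lemma SL2_mul_continuous : continuous (fun MN : SL2 * SL2 => MN.1 * MN.2).
Proof.
apply: continuous_SL2; apply: continuous_mx => i j MN.
pose t k (MN : SL2 * SL2) : R := (SL2_mx MN.1 i k * SL2_mx MN.2 k j)%R.
have tc k : continuous (t k).
  move=> x; apply: cvgM.
    by apply: (@continuous_comp _ _ _ fst (fun M => SL2_mx M i k));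
      [exact: cvg_fst|exact: SL2_coord_continuous].
  by apply: (@continuous_comp _ _ _ snd (fun M => SL2_mx M k j));
    [exact: cvg_snd|exact: SL2_coord_continuous].
rewrite (_ : (fun _ => _) = (fun MN => t ord0 MN + t (lift ord0 ord0) MN)%R).
  by apply: cvgD; exact: tc.
by apply/funext => x; rewrite /= mxE big_ord_recl big_ord1.
Qed.

Lemma SL2_opp_continuous : continuous SL2_opp.
Proof.
apply: continuous_SL2; apply: continuous_mx => i j M.
rewrite (_ : (fun _ => _) = (fun M : SL2 => - SL2_mx M i j)%R); last first.
  by apply/funext => x; rewrite /= mxE.
exact: (cvgN (@SL2_coord_continuous i j M)).
Qed.

Lemma SL2_inv_continuous : continuous (fun M => M^-1).
Proof.
apply: continuous_SL2; apply: continuous_mx => i j M.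
rewrite (_ : (fun _ => _) = (fun M : SL2 =>
   (-1) ^+ (j + i) * SL2_mx M (lift j ord0) (lift i ord0))%R); last first.
  apply/funext => x; rewrite /= /invmx SL2_unit SL2_det invr1 scale1r mxE.
  by rewrite /cofactor det_mx11 !mxE.
exact: (cvgMr (@SL2_coord_continuous _ _ M)).
Qed.

Lemma PSL2_pi_continuous : continuous (\pi_PSL2 : SL2 -> PSL2).
Proof. exact: pi_continuous. Qed.

Lemma PSL2_pi_open (U : set SL2) : open U -> open (\pi_PSL2 @` U : set PSL2).
Proof.
move=> oU; rewrite /open/= /quotient_open.
rewrite (_ : _ @^-1` _ = U `|` SL2_opp @^-1` U).
  by apply: openU => //; move/continuousP: SL2_opp_continuous; apply.
apply/seteqP; split=> M /=.
  by case=> N UN /PSL2_eqP[<-|E]; [left|right; rewrite /= -E].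
by case=> UM; [exists M|exists (SL2_opp M) => //; rewrite PSL2_piN].
Qed.

Lemma PSL2_mul_continuous : continuous (fun pq : PSL2 * PSL2 => pq.1 * pq.2).
Proof.
move=> [p q] W; have [[M ->] [N ->]] := (PSL2P p, PSL2P q).
rewrite [_ * _]PSL2_mul_pi nbhs_simpl/= => nW.
have nW' : nbhs (M * N) (\pi_PSL2 @^-1` W) by exact: PSL2_pi_continuous.
have [[U V] /= [nU nV] UV] := @SL2_mul_continuous (M, N) _ nW'.
exists (\pi_PSL2 @` U, \pi_PSL2 @` V) => /=.
  split; [move: nU|move: nV]; rewrite nbhsE => -[B [oB Bx] BU].
    apply: (@filterS _ _ _ (\pi_PSL2 @` B)); first exact: image_subset.
    by apply: open_nbhs_nbhs; split; [exact: PSL2_pi_open|exists M].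
  apply: (@filterS _ _ _ (\pi_PSL2 @` B)); first exact: image_subset.
  by apply: open_nbhs_nbhs; split; [exact: PSL2_pi_open|exists N].
move=> [_ _] /= [[M' UM <-] [N' VN <-]].
by rewrite [_ * _]PSL2_mul_pi; exact: (UV (M', N')).
Qed.

Lemma PSL2_inv_continuous : continuous (fun p => p^-1).
Proof.
apply/quotient_continuous => M.
rewrite (_ : _ \o _ = \pi_PSL2 \o (fun M : SL2 => M^-1)); last first.
  by apply/funext => N /=; exact: PSL2_inv_pi.
by apply: continuous_comp; [exact: SL2_inv_continuous|exact: PSL2_pi_continuous].
Qed.

End SpecialLinear.

Section UniversalCover.
Context (R : realType).
Local Notation G := (PSL2 R).
Local Notation I01 := (`[(0 : R)%R, (1 : R)%R]%classic : set R).

Definition based_path (c : R -> G) : Prop :=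
  {within I01, continuous c} /\ c 0%R = 1.

Definition homotopic (c d : R -> G) : Prop :=
  exists h : R * R -> G, [/\ {within I01 `*` I01, continuous h},
    forall t, I01 t -> h (t, 0%R) = c t,
    forall t, I01 t -> h (t, 1%R) = d t,
    forall u, I01 u -> h (0%R, u) = c 0%R &
    forall u, I01 u -> h (1%R, u) = c 1%R].

Let I1 : I01 (1%R : R). Proof. by rewrite /= in_itv/= lexx ler01. Qed.

Lemma continuous_mulPSL2 (X : topologicalType) (f g : X -> G) :
  continuous f -> continuous g -> continuous (fun x => f x * g x).
Proof.
move=> fc gc x; apply: (@continuous2_cvg _ _ _ _ _ _ f g
  (fun p q => p * q) (f x) (g x)); [|exact: fc|exact: gc].
exact: PSL2_mul_continuous (f x, g x).
Qed.

Lemma continuous_invPSL2 (X : topologicalType) (f : X -> G) :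
  continuous f -> continuous (fun x => (f x)^-1).
Proof.
by move=> fc x; apply: continuous_comp; [exact: fc|exact: PSL2_inv_continuous].
Qed.

Lemma homotopic_end c d : homotopic c d -> c 1%R = d 1%R.
Proof. by case=> h [_ _ hd _ h1]; rewrite -hd// h1. Qed.

Lemma square_fst_continuous (c : R -> G) :
  {within I01, continuous c} -> {within I01 `*` I01, continuous (c \o fst)}.
Proof.
move=> /subspace_continuousP cc; apply/subspace_continuousP => -[t u] [/= It Iu].
move=> W nW; exists ([set a | I01 a -> W (c a)], setT) => /=.
  by split; [exact: cc nW|exact: (@filterT _ (nbhs (u : R)))].
by move=> [a b] /= [H _] [Ia _]; exact: H.
Qed.

Lemma homotopic_refl c : {within I01, continuous c} -> homotopic c c.
Proof.
by move=> cc; exists (c \o fst); split=> //; exact: square_fst_continuous.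
Qed.

Lemma homotopicM c c' d d' :
  homotopic c c' -> homotopic d d' ->
  homotopic (fun t => c t * d t) (fun t => c' t * d' t).
Proof.
move=> [h [hc h0 h1 hl hr]] [k [kc k0 k1 kl kr]].
exists (fun x => h x * k x); split.
- exact: continuous_mulPSL2.
- by move=> t It; rewrite h0// k0.
- by move=> t It; rewrite h1// k1.
- by move=> t It; rewrite hl// kl.
- by move=> t It; rewrite hr// kr.
Qed.

Lemma homotopicV c d :
  homotopic c d -> homotopic (fun t => (c t)^-1) (fun t => (d t)^-1).
Proof.
move=> [h [hc h0 h1 hl hr]]; exists (fun x => (h x)^-1); split.
- exact: continuous_invPSL2.
- by move=> t It; rewrite h0.
- by move=> t It; rewrite h1.
- by move=> t It; rewrite hl.
- by move=> t It; rewrite hr.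
Qed.

Lemma homotopic_trans c d e : {within I01, continuous d} ->
  homotopic c d -> homotopic d e -> homotopic c e.
Proof.
move=> dc cd de; have := homotopicM (homotopicM cd
  (homotopicV (homotopic_refl dc))) de.
rewrite (_ : (fun _ => _) = c); last by apply/funext => t; rewrite mulgVK.
by rewrite (_ : (fun _ => _) = e)//; apply/funext => t; rewrite mulgV mul1g.
Qed.

Lemma homotopic_sym c d :
  {within I01, continuous c} -> {within I01, continuous d} ->
  homotopic c d -> homotopic d c.
Proof.
move=> cc dc cd; have := homotopicM (homotopicM (homotopic_refl dc)
  (homotopicV cd)) (homotopic_refl cc).
rewrite (_ : (fun _ => _) = d); last by apply/funext => t; rewrite mulgVK.
by rewrite (_ : (fun _ => _) = c)//; apply/funext => t; rewrite mulgV mul1g.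
Qed.

Record pathPSL2 := MkPath { path_fun :> R -> G; _ : `[< based_path path_fun >] }.
HB.instance Definition _ := [isSub for path_fun].
HB.instance Definition _ := [Choice of pathPSL2 by <:].

Implicit Types c d e : pathPSL2.

Lemma based_pathP c : based_path c. Proof. by case: c => c /= /asboolP. Qed.

Definition homotopicb c d : bool := `[< homotopic c d >].

Fact homotopicb_refl : reflexive homotopicb.
Proof. by move=> c; apply/asboolP/homotopic_refl; case: (based_pathP c). Qed.
Fact homotopicb_sym : symmetric homotopicb.
Proof.
move=> c d; have [[cc _] [dc _]] := (based_pathP c, based_pathP d).
by apply/asboolP/asboolP; exact: homotopic_sym.
Qed.
Fact homotopicb_trans : transitive homotopicb.
Proof.
move=> d c e /asboolP cd /asboolP de; apply/asboolP.
by apply: homotopic_trans cd de; case: (based_pathP d).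
Qed.
Canonical homotopic_equiv :=
  EquivRel homotopicb homotopicb_refl homotopicb_sym homotopicb_trans.

Fact path_one_proof : `[< based_path (fun=> 1 : G) >].
Proof. by apply/asboolP; split=> //; move=> x; exact: cvg_cst. Qed.
Fact path_mul_proof c d : `[< based_path (fun t => c t * d t) >].
Proof.
have [[cc c0] [dc d0]] := (based_pathP c, based_pathP d); apply/asboolP; split.
  exact: continuous_mulPSL2.
by rewrite c0 d0 mul1g.
Qed.
Fact path_inv_proof c : `[< based_path (fun t => (c t)^-1) >].
Proof.
have [cc c0] := based_pathP c; apply/asboolP; split; first exact: continuous_invPSL2.
by rewrite c0 invg1.
Qed.
Definition path_one1 := MkPath path_one_proof.
Definition path_mul c d := MkPath (path_mul_proof c d).
Definition path_inv c := MkPath (path_inv_proof c).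

(* The universal covering group of PSL2 R, in its standard model: classes of
   paths issued from 1 modulo homotopy relative to the endpoints, with the
   pointwise product; the covering map sends a class to its endpoint. Only the
   values of the paths on `[0, 1] matter. *)
Definition uPSL2 : Type := {eq_quot homotopicb}.
HB.instance Definition _ := Quotient.on uPSL2.
HB.instance Definition _ := Choice.on uPSL2.

Implicit Types x y z : uPSL2.

Lemma uPSL2_eqP c d : \pi_uPSL2 c = \pi_uPSL2 d <-> homotopic c d.
Proof.
have E : reflect (\pi_uPSL2 c = \pi_uPSL2 d) (homotopicb c d).
  exact: (eqquotP {eq_quot homotopicb} c d).
by split=> [/E/asboolP|cd] //; apply/E/asboolP.
Qed.

Lemma uPSL2P x : exists c, x = \pi_uPSL2 c.
Proof. by exists (repr x); rewrite reprK. Qed.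

Lemma uPSL2_repr c : homotopic (repr (\pi_uPSL2 c)) c.
Proof. by apply/uPSL2_eqP; rewrite reprK. Qed.

Definition uPSL2_one : uPSL2 := \pi_uPSL2 path_one1.
Definition uPSL2_mul x y : uPSL2 := \pi_uPSL2 (path_mul (repr x) (repr y)).
Definition uPSL2_inv x : uPSL2 := \pi_uPSL2 (path_inv (repr x)).

Lemma uPSL2_mul_pi c d :
  uPSL2_mul (\pi_uPSL2 c) (\pi_uPSL2 d) = \pi_uPSL2 (path_mul c d).
Proof. by apply/uPSL2_eqP/homotopicM; exact: uPSL2_repr. Qed.

Lemma uPSL2_inv_pi c : uPSL2_inv (\pi_uPSL2 c) = \pi_uPSL2 (path_inv c).
Proof. by apply/uPSL2_eqP/homotopicV; exact: uPSL2_repr. Qed.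

Fact uPSL2_mulA : associative uPSL2_mul.
Proof.
move=> x y z; have [[[c ->] [d ->]] [e ->]] := (uPSL2P x, uPSL2P y, uPSL2P z).
rewrite !uPSL2_mul_pi; congr (\pi_uPSL2 _); apply/val_inj/funext => t /=.
by rewrite mulgA.
Qed.
Fact uPSL2_mul1 : left_id uPSL2_one uPSL2_mul.
Proof.
move=> x; have [c ->] := uPSL2P x; rewrite uPSL2_mul_pi.
by congr (\pi_uPSL2 _); apply/val_inj/funext => t /=; rewrite mul1g.
Qed.
Fact uPSL2_mulr1 : right_id uPSL2_one uPSL2_mul.
Proof.
move=> x; have [c ->] := uPSL2P x; rewrite uPSL2_mul_pi.
by congr (\pi_uPSL2 _); apply/val_inj/funext => t /=; rewrite mulg1.
Qed.
Fact uPSL2_mulV : left_inverse uPSL2_one uPSL2_inv uPSL2_mul.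
Proof.
move=> x; have [c ->] := uPSL2P x; rewrite uPSL2_inv_pi uPSL2_mul_pi.
by congr (\pi_uPSL2 _); apply/val_inj/funext => t /=; rewrite mulVg.
Qed.
Fact uPSL2_mulrV : right_inverse uPSL2_one uPSL2_inv uPSL2_mul.
Proof.
move=> x; have [c ->] := uPSL2P x; rewrite uPSL2_inv_pi uPSL2_mul_pi.
by congr (\pi_uPSL2 _); apply/val_inj/funext => t /=; rewrite mulgV.
Qed.

HB.instance Definition _ := isGroup.Build uPSL2
  uPSL2_mulA uPSL2_mul1 uPSL2_mulr1 uPSL2_mulV uPSL2_mulrV.

Definition covering_map x : G := repr x 1%R.

Lemma covering_map_pi c : covering_map (\pi_uPSL2 c) = c 1%R.
Proof. by apply: homotopic_end; exact: uPSL2_repr. Qed.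

Fact covering_mapM : {morph covering_map : x y / x * y}.
Proof.
move=> x y; have [[c ->] [d ->]] := (uPSL2P x, uPSL2P y).
by rewrite [X in covering_map X]uPSL2_mul_pi !covering_map_pi.
Qed.
HB.instance Definition _ := isMultiplicative.Build uPSL2 G covering_map
  covering_mapM.

End UniversalCover.

Section AmalgamatedProduct.
Context (K G H : groupType) (f : {multiplicative K -> G})
  (g : {multiplicative K -> H}).

Local Notation word := (seq (G + H)).

Inductive amalg_rel : word -> word -> Prop :=
| AmalgRefl w : amalg_rel w w
| AmalgSym v w : amalg_rel v w -> amalg_rel w v
| AmalgTrans u v w : amalg_rel u v -> amalg_rel v w -> amalg_rel u w
| AmalgCat u v u' v' :
    amalg_rel u u' -> amalg_rel v v' -> amalg_rel (u ++ v) (u' ++ v')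
| AmalgMulL x y : amalg_rel [:: inl x; inl y] [:: inl (x * y)]
| AmalgMulR x y : amalg_rel [:: inr x; inr y] [:: inr (x * y)]
| AmalgOneL : amalg_rel [:: inl 1] [::]
| AmalgOneR : amalg_rel [:: inr 1] [::]
| AmalgGlue k : amalg_rel [:: inl (f k)] [:: inr (g k)].

Definition amalg_relb (v w : word) : bool := `[< amalg_rel v w >].

Fact amalg_relb_refl : reflexive amalg_relb.
Proof. by move=> w; apply/asboolP; exact: AmalgRefl. Qed.
Fact amalg_relb_sym : symmetric amalg_relb.
Proof. by move=> v w; apply/asboolP/asboolP; exact: AmalgSym. Qed.
Fact amalg_relb_trans : transitive amalg_relb.
Proof.
by move=> v u w /asboolP uv /asboolP vw; apply/asboolP; exact: AmalgTrans uv vw.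
Qed.
Canonical amalg_equiv :=
  EquivRel amalg_relb amalg_relb_refl amalg_relb_sym amalg_relb_trans.

(* The amalgamated product of G and H along f and g: the monoid presented by
   the elements of G and H, the multiplication tables and f k = g k, which is
   the pushout of f and g in the category of groups. *)
Definition amalgam : Type := {eq_quot amalg_relb}.
HB.instance Definition _ := Quotient.on amalgam.
HB.instance Definition _ := Choice.on amalgam.

Implicit Types (u v w : word) (x y z : amalgam).

Lemma amalgam_eqP v w : \pi_amalgam v = \pi_amalgam w <-> amalg_rel v w.
Proof.
have E : reflect (\pi_amalgam v = \pi_amalgam w) (amalg_relb v w).
  exact: (eqquotP {eq_quot amalg_relb} v w).
by split=> [/E/asboolP|vw] //; apply/E/asboolP.
Qed.

Lemma amalgamP x : exists w, x = \pi_amalgam w.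
Proof. by exists (repr x); rewrite reprK. Qed.

Lemma amalgam_repr w : amalg_rel (repr (\pi_amalgam w)) w.
Proof. by apply/amalgam_eqP; rewrite reprK. Qed.

Definition letter_inv (a : G + H) : G + H :=
  match a with inl x => inl x^-1 | inr y => inr y^-1 end.
Definition word_inv w : word := rev (map letter_inv w).

Lemma word_inv_cat v w : word_inv (v ++ w) = word_inv w ++ word_inv v.
Proof. by rewrite /word_inv map_cat rev_cat. Qed.

Lemma word_inv_rel v w : amalg_rel v w -> amalg_rel (word_inv v) (word_inv w).
Proof.
elim=> {v w} [w|v w _ IH|u v w _ IH1 _ IH2|u v u' v' _ IH1 _ IH2|x y|x y|||k].
- exact: AmalgRefl.
- exact: AmalgSym.
- exact: AmalgTrans IH1 IH2.
- by rewrite !word_inv_cat; exact: AmalgCat.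
- by rewrite /word_inv/= invgM; exact: AmalgMulL.
- by rewrite /word_inv/= invgM; exact: AmalgMulR.
- by rewrite /word_inv/= invg1; exact: AmalgOneL.
- by rewrite /word_inv/= invg1; exact: AmalgOneR.
- have morphV (M : groupType) (h : {multiplicative K -> M}) : (h k)^-1 = h k^-1.
    have h1 : h 1 = 1 by apply: (mulgI (h 1)); rewrite -gmulfM !mulg1.
    by apply: (mulgI (h k)); rewrite -gmulfM !mulgV h1.
  by rewrite /word_inv/= !morphV; exact: AmalgGlue.
Qed.

Lemma word_mulV w : amalg_rel (w ++ word_inv w) [::].
Proof.
elim: w => [|a w IH]; first exact: AmalgRefl.
rewrite -cat1s word_inv_cat -catA [w ++ _]catA.
apply: (@AmalgTrans _ ([:: a] ++ ([::] ++ word_inv [:: a]))).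
  by do 2?[apply: AmalgCat]; rewrite //; exact: AmalgRefl.
case: a => a; rewrite /word_inv/=.
  by apply: AmalgTrans (AmalgMulL _ _) _; rewrite mulgV; exact: AmalgOneL.
by apply: AmalgTrans (AmalgMulR _ _) _; rewrite mulgV; exact: AmalgOneR.
Qed.

Lemma word_invK : involutive word_inv.
Proof.
move=> w; rewrite /word_inv map_rev revK -map_comp map_id_in// => -[] a _ /=;
by rewrite invgK.
Qed.

Definition amalgam_one : amalgam := \pi_amalgam [::].
Definition amalgam_mul x y : amalgam := \pi_amalgam (repr x ++ repr y).
Definition amalgam_inv x : amalgam := \pi_amalgam (word_inv (repr x)).

Lemma amalgam_mul_pi v w :
  amalgam_mul (\pi_amalgam v) (\pi_amalgam w) = \pi_amalgam (v ++ w).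
Proof. by apply/amalgam_eqP/AmalgCat; exact: amalgam_repr. Qed.

Lemma amalgam_inv_pi w : amalgam_inv (\pi_amalgam w) = \pi_amalgam (word_inv w).
Proof. by apply/amalgam_eqP/word_inv_rel; exact: amalgam_repr. Qed.

Fact amalgam_mulA : associative amalgam_mul.
Proof.
move=> x y z.
have [[[u ->] [v ->]] [w ->]] := (amalgamP x, amalgamP y, amalgamP z).
by rewrite !amalgam_mul_pi catA.
Qed.
Fact amalgam_mul1 : left_id amalgam_one amalgam_mul.
Proof. by move=> x; have [w ->] := amalgamP x; rewrite amalgam_mul_pi. Qed.
Fact amalgam_mulr1 : right_id amalgam_one amalgam_mul.
Proof. by move=> x; have [w ->] := amalgamP x; rewrite amalgam_mul_pi cats0. Qed.
Fact amalgam_mulrV : right_inverse amalgam_one amalgam_inv amalgam_mul.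
Proof.
move=> x; have [w ->] := amalgamP x; rewrite amalgam_inv_pi amalgam_mul_pi.
by apply/amalgam_eqP; exact: word_mulV.
Qed.
Fact amalgam_mulV : left_inverse amalgam_one amalgam_inv amalgam_mul.
Proof.
move=> x; have [w ->] := amalgamP x; rewrite amalgam_inv_pi amalgam_mul_pi.
by apply/amalgam_eqP; rewrite -[X in _ ++ X]word_invK; exact: word_mulV.
Qed.

HB.instance Definition _ := isGroup.Build amalgam
  amalgam_mulA amalgam_mul1 amalgam_mulr1 amalgam_mulV amalgam_mulrV.

End AmalgamatedProduct.

(* The infinite cyclic group: the group law is the addition of int. *)
Definition Zgroup : Type := int.
HB.instance Definition _ := Choice.on Zgroup.
HB.instance Definition _ := isGroup.Build Zgroup
  (@addrA int) (@add0r int) (@addr0 int) (@addNr int) (@addrN int).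

Section Subgroups.
Context (A : groupType) (C : groupClosed A).

Record subgroup_of := SubgroupOf { sub_incl : A; _ : sub_incl \in C }.
HB.instance Definition _ := [isSub for sub_incl].
HB.instance Definition _ := [Choice of subgroup_of by <:].
Implicit Types c d e : subgroup_of.

Fact sub_incl_in c : sub_incl c \in C. Proof. by case: c. Qed.
Definition sub_one := SubgroupOf (@gpred1 _ C).
Definition sub_mul c d :=
  SubgroupOf (@gpredM _ C (sub_incl c) (sub_incl d) (sub_incl_in c) (sub_incl_in d)).
Definition sub_inv c := SubgroupOf (@gpredVr _ C (sub_incl c) (sub_incl_in c)).
Fact sub_mulA : associative sub_mul.
Proof. by move=> c d e; apply: val_inj; rewrite /= mulgA. Qed.
Fact sub_mul1 : left_id sub_one sub_mul.
Proof. by move=> c; apply: val_inj; rewrite /= mul1g. Qed.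
Fact sub_mulr1 : right_id sub_one sub_mul.
Proof. by move=> c; apply: val_inj; rewrite /= mulg1. Qed.
Fact sub_mulV : left_inverse sub_one sub_inv sub_mul.
Proof. by move=> c; apply: val_inj; rewrite /= mulVg. Qed.
Fact sub_mulrV : right_inverse sub_one sub_inv sub_mul.
Proof. by move=> c; apply: val_inj; rewrite /= mulgV. Qed.
HB.instance Definition _ := isGroup.Build subgroup_of
  sub_mulA sub_mul1 sub_mulr1 sub_mulV sub_mulrV.

Fact sub_inclM : {morph sub_incl : c d / c * d}. Proof. by []. Qed.
HB.instance Definition _ :=
  isMultiplicative.Build subgroup_of A sub_incl sub_inclM.

Definition sub_pair c : subgroup_of * Zgroup := (c, 1).
Fact sub_pairM : {morph sub_pair : c d / c * d}.
Proof. by move=> c d; congr (_, _); rewrite /= mulg1. Qed.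
HB.instance Definition _ :=
  isMultiplicative.Build subgroup_of (subgroup_of * Zgroup)%type sub_pair sub_pairM.

Definition abelian_subgroup : Prop := {in C &, forall x y, commute x y}.

Definition malnormal : Prop := forall g : A, g \notin C ->
  [set x ^ g | x in [set` C]] `&` [set` C] = [set 1].

(* The amalgamated product of two copies of A along the identity of C. *)
Definition double_along : groupType := amalgam sub_incl sub_incl.

(* A *_C (C x Z), that is, the HNN extension of A along the identity of C. *)
Definition HNN_along : groupType := amalgam sub_incl sub_pair.

End Subgroups.

Definition finitely_generated (L : groupType) : Prop :=
  exists s : seq L, forall H : groupClosed L,
    {subset s <= H} -> forall x, x \in H.

Definition torsion (L : groupType) : set L :=
  [set g | exists2 n, (0 < n)%N & g ^+ n = 1].
Arguments torsion : clear implicits.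

Definition discrete (T : topologicalType) (D : set T) : Prop :=
  D `<=` isolated D.

Section Representations.
Context (R : realType) (L : groupType).
Implicit Types (rho : {multiplicative L -> PSL2 R})
  (Lambda : set {multiplicative L -> PSL2 R}).

Definition parabolic (p : PSL2 R) : Prop := p <> 1 /\ tr2 p = 4%:R%R.

Definition parabolic_free rho : Prop := forall g, ~ parabolic (rho g).

Definition indiscrete rho : Prop := ~ discrete (range rho).

Definition faithful rho : Prop := injective rho.

Definition liftable rho : Prop :=
  exists lift : {multiplicative L -> uPSL2 R},
    forall g, rho g = covering_map (lift g).

Definition tracially_disjoint Lambda : Prop :=
  forall rho lambda, Lambda rho -> Lambda lambda -> rho <> lambda ->
    [set tr2 (rho g) | g in ~` torsion L] `&`
    [set tr2 (lambda g) | g in ~` torsion L] = set0.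

Definition flexible_family Lambda : Prop :=
  [/\ ~ countable Lambda, tracially_disjoint Lambda &
    forall rho, Lambda rho ->
      [/\ indiscrete rho, faithful rho & parabolic_free rho]].

Definition flexible : Prop :=
  finitely_generated L /\ exists Lambda, flexible_family Lambda.

Definition liftable_flexible : Prop :=
  finitely_generated L /\
  exists Lambda, flexible_family Lambda /\
    forall rho, Lambda rho -> liftable rho.

End Representations.

(* Main.v *)
Require Import Defs.
From HB Require Import structures.
From mathcomp Require Import all_boot all_order all_algebra.
From mathcomp Require Import generic_quotient complex ring lra.
From mathcomp Require Import all_classical all_reals topology normedtype.
From mathcomp Require Import derive realfun lebesgue_measure.
Import numFieldNormedType.Exports.

(** Let rho be a faithful parabolic-free representation of A. The abelian group
    rho(C) lies in a one-parameter subgroup P of PSL2(R), elliptic or hyperbolic.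
    Sending the stable letter to an element z of P, respectively representing the
    second copy of A by the conjugate of rho by z, extends rho to the HNN extension
    or to the double. The point is that for all z outside a countable set the
    extension creates no unwanted trace.

    Write J for a traceless matrix spanning the Lie algebra of P and consider a
    cyclically reduced word a_1 z^e_1 ... a_k z^e_k with e_i = 1 or -1. As z runs
    over a curve in P, the square of its trace is p(u)^2 / d(u)^k with p and d real
    polynomials. At a complex zero u_0 of d, the matrices representing z and z^-1
    degenerate to multiples of the two projectors on the eigenlines of J, so that
    p(u_0) is, up to a nonzero scalar, a product of entries of the rho(a_i) in an
    eigenbasis of J ([word_trace_neq0]). Those entries do not vanish: otherwise, for
    a nontrivial c in C, some a outside C would make c and c ^ a share a fixed point,
    their commutator would have trace 2 and would be trivial since rho has no
    parabolics, and malnormality excludes this ([axis_of_subgroup]). When C is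
    trivial, a generic elliptic J does as well ([axis_trivial]). Hence p(u_0) is not
    zero while d(u_0) is, the squared trace is not constant, and it takes each value
    finitely many times ([axis_word_tr2_finite]).

    Every element of the HNN extension or of the double is conjugate into a copy of
    A or to a cyclically reduced word. Avoiding the value 4 therefore makes the
    extension faithful and parabolic-free, and any prescribed countable set of values
    can be avoided as well ([hnn_extension], [double_extension]). A tracially disjoint set of such
    extensions that is maximal cannot be countable: some member of the given family
    would share no trace with it, and a generic extension of that member could be
    added ([flexible_family_extension]).

    Finally, if rho lifts to the universal cover, the path in P from 1 to z defines
    a lift of z that commutes with the lift of rho(C), by an explicit homotopy
    ([axis_lift_commute]), and the same extension can be made upstairs. *)

Set Implicit Arguments.
Unset Strict Implicit.
Unset Printing Implicit Defensive.

Import Order.TTheory GRing.Theory Num.Theory.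

Local Open Scope classical_set_scope.
Local Open Scope quotient_scope.
Local Open Scope ring_scope.

(** * Two by two matrices *)

Section TwoByTwo.
Variable F : comNzRingType.
Implicit Types M N J : 'M[F]_2.

Lemma trace2 M : \tr M = M 0 0 + M 1 1.
Proof.
rewrite /mxtrace !big_ord_recl big_ord0 addr0.
by congr (_ + M _ _); apply/val_inj.
Qed.

Lemma det2 M : \det M = M 0 0 * M 1 1 - M 0 1 * M 1 0.
Proof.
rewrite (expand_det_row _ 0) !big_ord_recl big_ord0 addr0 /cofactor !det_mx11 !mxE /=.
rewrite expr0 mul1r /bump /= addn0 expr1 mulN1r mulrN.
by congr (M _ _ * M _ _ - M _ _ * M _ _); apply/val_inj.
Qed.

Lemma mul2E M N i j : (M * N) i j = M i 0 * N 0 j + M i 1 * N 1 j.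
Proof.
rewrite mxE !big_ord_recl big_ord0 addr0.
by congr (_ + M _ _ * N _ _); apply/val_inj.
Qed.

Lemma matrix2P M N :
  M 0 0 = N 0 0 -> M 0 1 = N 0 1 -> M 1 0 = N 1 0 -> M 1 1 = N 1 1 -> M = N.
Proof.
move=> e00 e01 e10 e11; apply/matrixP => i j.
have o2 (k : 'I_2) : k = 0 \/ k = 1.
  by case: k => -[|[|//]] k; [left|right]; apply/val_inj.
by case: (o2 i) => ->; case: (o2 j) => ->.
Qed.

(** If J = diag (s, -s), this is 4 s^2 times the product of the diagonal entries
    of M; when M moreover has determinant 1, adding 4 det J turns it into 4 s^2
    times the product of the off-diagonal entries. So its two forbidden values
    0 and - 4 det J detect a vanishing entry of M in an eigenbasis of J, which
    itself may live only in a quadratic extension. *)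
Definition axis_form J M : F := - \det J * (\tr M) ^+ 2 - (\tr (J * M)) ^+ 2.

Lemma axis_formJ (Q Q' J M : 'M[F]_2) : Q' * Q = 1 ->
  axis_form (Q * J * Q') (Q * M * Q') = axis_form J M.
Proof.
move=> QQ; rewrite /axis_form.
have trJ X : \tr (Q * X * Q') = \tr X.
  rewrite [X in \tr X](_ : _ = (Q *m X) *m Q')// mxtrace_mulC.
  by rewrite mulmxA [Q' *m Q]QQ mul1mx.
have dJ : \det (Q * J * Q') = \det J.
  rewrite [X in \det X](_ : _ = (Q *m J) *m Q')// !det_mulmx mulrC mulrA.
  by rewrite -det_mulmx [Q' *m Q]QQ det1 mul1r.
rewrite trJ dJ (_ : Q * J * Q' * _ = Q * (J * M) * Q') ?trJ//.
by rewrite -!mulrA (mulrA Q') QQ mul1r.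
Qed.

(** An off-diagonal entry of M vanishes when M and J share an eigenline, which
    is what the determinant of their bracket detects. *)
Lemma axis_form_commutator J M : \tr J = 0 -> \det M = 1 ->
  axis_form J M + 4 * \det J = \det (M * J - J * M).
Proof.
have E i j : (M * J - J * M) i j = (M * J) i j - (J * M) i j by rewrite !mxE.
rewrite /axis_form !trace2 !det2 !E !mul2E => tJ dM.
have -> : J 1 1 = - J 0 0 by apply/eqP; rewrite -subr_eq0 opprK addrC tJ.
have dM' : M 0 0 * M 1 1 = 1 + M 0 1 * M 1 0 by rewrite -dM; ring.
ring: dM'.
Qed.

Lemma inv2E M M' : \det M = 1 -> M * M' = 1 ->
  [/\ M' 0 0 = M 1 1, M' 0 1 = - M 0 1, M' 1 0 = - M 1 0 & M' 1 1 = M 0 0].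
Proof.
move=> dM MM; pose A : 'M[F]_2 := \matrix_(i, j)
  (if i == 0 then if j == 0 then M 1 1 else - M 0 1
   else if j == 0 then - M 1 0 else M 0 0).
have AM : A * M = 1.
  by move: (det2 M); rewrite dM => d; apply: matrix2P; rewrite mul2E !mxE/= ?d; ring.
have -> : M' = A by rewrite -[M']mul1r -AM -mulrA MM mulr1.
by rewrite !mxE.
Qed.

(** In an eigenbasis of J, the matrices J and M^-1 J M share an eigenline exactly
    when some entry of M vanishes; the right-hand side is 16 s^4 times the
    product of the four entries of M, up to sign. *)
Lemma axis_form_conj J M M' : \tr J = 0 -> \det M = 1 -> M * M' = 1 ->
  \det (M' * J * M * J - J * (M' * J * M)) =
  axis_form J M * (- 4 * \det J - axis_form J M).
Proof.
have E i j : (M' * J * M * J - J * (M' * J * M)) i j =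
    (M' * J * M * J) i j - (J * (M' * J * M)) i j by rewrite !mxE.
move=> tJ dM MM; have [m00 m01 m10 m11] := inv2E dM MM.
move: tJ dM; rewrite /axis_form !trace2 !det2 !E !mul2E m00 m01 m10 m11 => tJ dM.
have -> : J 1 1 = - J 0 0 by apply/eqP; rewrite -subr_eq0 opprK addrC tJ.
have dM' : M 0 0 * M 1 1 = 1 + M 0 1 * M 1 0 by rewrite -dM; ring.
ring: dM'.
Qed.

End TwoByTwo.

(** * The trace of a cyclic word at a degenerate point *)

(** Two consecutive letters (M, e) and (M', e') of a word contribute to its trace
    the entry of M' that links the eigenline of J selected by e to the one
    selected by e'; the relation says that this entry is not zero. *)
Definition transverse (F : comNzRingType) (J : 'M[F]_2) (x y : 'M[F]_2 * bool) :=
  if x.2 == y.2 then axis_form J y.1 != 0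
  else axis_form J y.1 + 4 * \det J != 0.

Section TraceOfWord.
Variable F : fieldType.
Hypothesis nz2 : 2 != 0 :> F.
Implicit Types (J : 'M[F]_2) (x y : 'M[F]_2 * bool).

Let line (b : bool) : 'I_2 := if b then 0 else 1.

Lemma axis_eigenbasis J (sigma : F) :
  \tr J = 0 -> \det J = - sigma ^+ 2 -> sigma != 0 ->
  exists Q Q', [/\ Q * Q' = 1, Q' * Q = 1,
    Q * (sigma%:M + J) * Q' = (2 * sigma) *: delta_mx 0 0 &
    Q * (sigma%:M - J) * Q' = (2 * sigma) *: delta_mx 1 1].
Proof.
rewrite trace2 det2 => tJ dJ s0.
have J11 : J 1 1 = - J 0 0 by apply/eqP; rewrite -subr_eq0 opprK addrC tJ.
have {}dJ : sigma ^+ 2 = J 0 0 ^+ 2 + J 0 1 * J 1 0.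
  by move: dJ; rewrite J11 => /(congr1 -%R); rewrite opprK => <-; ring.
(* If the row (p, q) is not an eigenvector of J, its images under J + sigma and
   J - sigma are independent eigenvectors; the quadratic form below is the
   determinant of (p, q) and its image under J. *)
have [p [q pq]] : exists p q, p ^+ 2 * J 0 1 - 2 * p * q * J 0 0 - q ^+ 2 * J 1 0 != 0.
  have [b0|b0] := eqVneq (J 0 1) 0; last first.
    by exists 1, 0; rewrite (_ : _ - _ = J 0 1)//; ring.
  have [c0|c0] := eqVneq (J 1 0) 0; last first.
    by exists 0, 1; rewrite (_ : _ - _ = - J 1 0) ?oppr_eq0//; ring.
  exists 1, 1; rewrite b0 c0 (_ : _ - _ = - (2 * J 0 0)) ?oppr_eq0 ?mulf_neq0//.
    2: by ring.
  by apply: contra_neq s0 => a0; apply/eqP; rewrite -sqrf_eq0 dJ a0 b0 mul0r expr0n addr0.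
pose Q : 'M[F]_2 := \matrix_(i, j) let s := if i == 0 then sigma else - sigma in
  if j == 0 then p * (J 0 0 + s) + q * J 1 0 else p * J 0 1 + q * (- J 0 0 + s).
have Q00 : Q 0 0 = p * (J 0 0 + sigma) + q * J 1 0 by rewrite mxE.
have Q01 : Q 0 1 = p * J 0 1 + q * (- J 0 0 + sigma) by rewrite mxE.
have Q10 : Q 1 0 = p * (J 0 0 - sigma) + q * J 1 0 by rewrite mxE.
have Q11 : Q 1 1 = p * J 0 1 + q * (- J 0 0 - sigma) by rewrite mxE.
clearbody Q.
have dQ : \det Q = 2 * sigma * (p ^+ 2 * J 0 1 - 2 * p * q * J 0 0 - q ^+ 2 * J 1 0).
  by rewrite det2 Q00 Q01 Q10 Q11; ring.
have uQ : Q \in unitmx by rewrite unitmxE unitfE dQ !mulf_neq0.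
have QQ : Q * invmx Q = 1 by apply: mulmxV.
have QQ' : invmx Q * Q = 1 by apply: mulVmx.
exists Q, (invmx Q); split=> //.
  rewrite (_ : Q * _ = ((2 * sigma) *: delta_mx 0 0) * Q); first by rewrite -mulrA QQ mulr1.
  by apply: matrix2P; rewrite !mul2E !mxE/= ?Q00 ?Q01 ?Q10 ?Q11 ?J11; ring: dJ.
rewrite (_ : Q * _ = ((2 * sigma) *: delta_mx 1 1) * Q); first by rewrite -mulrA QQ mulr1.
by apply: matrix2P; rewrite !mul2E !mxE/= ?Q00 ?Q01 ?Q10 ?Q11 ?J11; ring: dJ.
Qed.

Lemma delta_path x p i :
  path (fun x y => y.1 (line x.2) (line y.2) != 0) x p ->
  exists2 c, c != 0 & delta_mx i (line x.2) *
      \prod_(y <- p) (y.1 * delta_mx (line y.2) (line y.2)) =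
    c *: delta_mx i (line (last x p).2) :> 'M[F]_2.
Proof.
elim: p x => [|y p IH] x /=; first by exists 1; rewrite ?oner_eq0// big_nil mulr1 scale1r.
case/andP => xy /IH [c c0 cE]; set l := y.1 _ _ in xy.
exists (l * c); first by rewrite mulf_neq0.
rewrite big_cons mulrA (_ : delta_mx i _ * _ = l *: delta_mx i (line y.2)).
  by rewrite -scalerAl cE scalerA.
apply/matrixP => k k'; rewrite mul2E !mul2E !mxE.
rewrite /l /line; case: x.2; case: y.2; case: (k == i);
  by rewrite /= ?(mulr0, mul0r, mulr1, mul1r, addr0, add0r).
Qed.

Lemma delta_cycle s : s != [::] ->
  cycle (fun x y => y.1 (line x.2) (line y.2) != 0) s ->
  \tr (\prod_(y <- s) (y.1 * delta_mx (line y.2) (line y.2))) != 0 :> F.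
Proof.
case/lastP: s => // p x _; rewrite (cycle_path x) last_rcons.
move=> /(delta_path (line x.2))[c c0]; rewrite last_rcons => cE.
rewrite -cats1 big_cat big_seq1 /=; set P := \prod_(y <- p) _ in cE *.
move: cE; rewrite -cats1 big_cat big_seq1 /= -/P => cE.
have dd i : delta_mx i i * delta_mx i i = delta_mx i i :> 'M[F]_2 by exact: mul_delta_mx.
set D := delta_mx (line x.2) (line x.2).
rewrite -[D]dd !mulrA [X in \tr X](_ : _ = (P * x.1 * D) *m D)//.
rewrite mxtrace_mulC -mulrA [X in \tr X]cE mxtraceZ trace2 !mxE.
by rewrite /line; case: (x.2); rewrite /= ?addr0 ?add0r mulr1.
Qed.

(** The factors sigma + J and sigma - J are multiples of the projectors on the two
    eigenlines of J. A product of rank one projectors separated by matrices has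
    for trace the product of the entries linking consecutive eigenlines. *)
Lemma word_trace_neq0 J (sigma : F) s :
  \tr J = 0 -> \det J = - sigma ^+ 2 -> sigma != 0 -> s != [::] ->
  {in s, forall y, \det y.1 = 1} -> cycle (transverse J) s ->
  \tr (\prod_(y <- s) (y.1 * (if y.2 then sigma%:M + J else sigma%:M - J))) != 0.
Proof.
move=> tJ dJ s0 sn ds cs.
have [Q [Q' [QQ' Q'Q Qp Qm]]] := axis_eigenbasis tJ dJ s0.
have [J' J'def J'E] : exists2 J', J' = Q * J * Q' &
    J' = sigma *: delta_mx 0 0 - sigma *: delta_mx 1 1.
  exists (Q * J * Q') => //; set J' := Q * J * Q'.
  have : 2 *: J' = (2 * sigma) *: delta_mx 0 0 - (2 * sigma) *: delta_mx 1 1.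
    rewrite -Qp -Qm -mulrBl -mulrBr (_ : _ - (_ - _) = 2 *: J).
      by rewrite -scalerAr -scalerAl.
    by apply/matrixP => i j; rewrite !mxE; ring.
  by rewrite -!scalerA -scalerBr => /(scalerI nz2).
have entry y z : \det z.1 = 1 -> transverse J y z ->
    (Q * z.1 * Q') (line y.2) (line z.2) != 0.
  move=> dz; rewrite /transverse -(axis_formJ J z.1 Q'Q) -J'def.
  have {dz}: \det (Q * z.1 * Q') = 1.
    rewrite [X in \det X](_ : _ = (Q *m z.1) *m Q')// !det_mulmx dz mulr1.
    by rewrite -det_mulmx [Q *m Q']QQ' det1.
  move: (Q * z.1 * Q') => N dN.
  have -> : \det J = \det J'.
    rewrite J'def [X in _ = \det X](_ : _ = (Q *m J) *m Q')// !det_mulmx mulrAC.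
    by rewrite -det_mulmx [Q *m Q']QQ' det1 mul1r.
  have -> : axis_form J' N = 4 * sigma ^+ 2 * (N 0 0 * N 1 1).
    by rewrite /axis_form det2 !trace2 !mul2E J'E !mxE/=; ring.
  have -> : \det J' = - sigma ^+ 2 by rewrite det2 J'E !mxE/=; ring.
  rewrite (_ : 4 * _ * _ + _ = 4 * sigma ^+ 2 * (N 0 1 * N 1 0)).
    rewrite /line; case: (y.2); case: (z.2) => /=;
    by apply: contraNN => /eqP ->; rewrite ?(mul0r, mulr0).
  have d : N 0 0 * N 1 1 = 1 + N 0 1 * N 1 0 by rewrite -dN det2; ring.
  by rewrite d; ring.
pose h (y : 'M[F]_2 * bool) := (Q * y.1 * Q', y.2).
have trE : \tr (\prod_(y <- s) (y.1 * (if y.2 then sigma%:M + J else sigma%:M - J)))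
    = (2 * sigma) ^+ size s *
      \tr (\prod_(y <- map h s) (y.1 * delta_mx (line y.2) (line y.2))).
  rewrite -mxtraceZ; set P := \prod_(y <- s) _.
  have -> : \tr P = \tr (Q * P * Q').
    rewrite [X in _ = \tr X](_ : _ = (Q *m P) *m Q')// mxtrace_mulC.
    by rewrite mulmxA [Q' *m Q]Q'Q mul1mx.
  congr (\tr _); rewrite /P big_map; elim: (s) => [|y t IH].
    by rewrite !big_nil mulr1 QQ' expr0 scale1r.
  rewrite !big_cons /= exprS -scalerA [_ ^+ _ *: _]scalerAr -IH scalerAl scalerAr.
  rewrite (_ : (2 * sigma) *: delta_mx _ _ =
    Q * (if y.2 then sigma%:M + J else sigma%:M - J) * Q'); last first.
    by rewrite /line; case: (y.2).
  by rewrite !mulrA -(mulrA _ Q' Q) Q'Q mulr1 -(mulrA _ Q' Q) Q'Q mulr1.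
rewrite trE mulf_neq0 ?expf_neq0 ?mulf_neq0//.
apply: delta_cycle; first by case: (s) sn.
rewrite cycle_map.
have ps : all (fun y => \det y.1 == 1) s by apply/allP => y /ds ->.
apply: sub_in_cycle ps cs => y z _ /eqP dz; exact: entry.
Qed.
End TraceOfWord.

(** * The curve in the centraliser of a traceless matrix *)

Lemma finite_roots (R : realType) (q : {poly R}) :
  q != 0 -> finite_set [set u | root q u]%classic.
Proof.
move=> q0; apply: contrapT => /(infinite_set_fset (size q))[B /= Bq].
apply/negP; rewrite -ltnNge; apply: max_poly_roots => //; last exact: finmap.fset_uniq.
by apply/allP => u /Bq.
Qed.

Section AxisSubgroup.
Variable R : realType.
Implicit Types (J : 'M[R]_2) (u : R).

(** The curve u |-> (axis_re J u + u J) / sqrt (axis_norm J u) lies in the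
    centraliser of J. The quadratic real part keeps the norm positive for every
    real u, also when J is hyperbolic, so that the parameter ranges over the
    whole line. *)
Definition axis_re J u : R := 1 + (1 + \det J ^+ 2) * u ^+ 2.
Definition axis_norm J u : R := axis_re J u ^+ 2 + \det J * u ^+ 2.

Lemma axis_norm_gt0 J u : 0 < axis_norm J u.
Proof.
rewrite /axis_norm /axis_re; set D := \det J; set v := u ^+ 2.
have v0 : 0 <= v by exact: sqr_ge0.
have : 0 <= (2 + 2 * D ^+ 2 + D) * v by rewrite mulr_ge0//; nra.
have : 0 <= ((1 + D ^+ 2) * v) ^+ 2 by exact: sqr_ge0.
nra.
Qed.

Lemma axis_normN J u : axis_norm J (- u) = axis_norm J u.
Proof. by rewrite /axis_norm /axis_re !sqrrN. Qed.

Definition axis_mx J u : 'M[R]_2 :=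
  (Num.sqrt (axis_norm J u))^-1 *: ((axis_re J u)%:M + u *: J).

Lemma det_axis_mx J u : \tr J = 0 -> \det (axis_mx J u) == 1.
Proof.
move=> tJ; have d0 := axis_norm_gt0 J u.
rewrite /axis_mx detZ exprVn sqr_sqrtr ?ltW//.
have -> : \det ((axis_re J u)%:M + u *: J) = axis_norm J u.
  move: tJ; rewrite trace2 => tJ.
  have J11 : J 1 1 = - J 0 0 by apply/eqP; rewrite -subr_eq0 opprK addrC tJ.
  by rewrite /axis_norm; move: (axis_re J u) => e; rewrite !det2 !mxE/= J11; ring.
by rewrite mulVf// gt_eqF.
Qed.

Definition axis_elt J (tJ : \tr J = 0) u : SL2 R := mkSL2 (det_axis_mx u tJ).

Lemma SL2_mulE (M N : SL2 R) : SL2_mx (M * N)%g = SL2_mx M * SL2_mx N.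
Proof. by []. Qed.

Lemma axis_elt0 J (tJ : \tr J = 0) : axis_elt tJ 0 = 1%g.
Proof.
apply/val_inj; rewrite /= /axis_mx /axis_norm /axis_re expr0n/= !mulr0 !addr0.
by rewrite expr1n sqrtr1 invr1 scale1r scale0r addr0.
Qed.

Lemma axis_eltN J (tJ : \tr J = 0) u : (axis_elt tJ u)^-1%g = axis_elt tJ (- u).
Proof.
apply: mulg1_eq; apply/val_inj; rewrite /= /axis_mx axis_normN.
have d0 := axis_norm_gt0 J u.
rewrite -scalemxAl -scalemxAr scalerA -invfM -expr2 sqr_sqrtr ?ltW//.
rewrite [_ *m _](_ : _ = (axis_norm J u)%:M).
  by rewrite scale_scalar_mx mulVf// gt_eqF.
rewrite /axis_norm (_ : axis_re J (- u) = axis_re J u); last by rewrite /axis_re sqrrN.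
move: tJ; rewrite trace2 => tJ.
have J11 : J 1 1 = - J 0 0 by apply/eqP; rewrite -subr_eq0 opprK addrC tJ.
rewrite [_ *m _]/(_ * _); move: (axis_re J u) => e.
by apply: matrix2P; rewrite mul2E det2 !mxE/= J11; ring.
Qed.

Lemma commute_axis_elt J (tJ : \tr J = 0) (M : SL2 R) u :
  J * SL2_mx M = SL2_mx M * J -> commute (axis_elt tJ u) M.
Proof.
move=> JM; apply/val_inj; rewrite /= /axis_mx -scalemxAl -scalemxAr.
by congr (_ *: _); rewrite mulmxDl mulmxDr scalar_mxC -scalemxAl -scalemxAr [J *m _]JM.
Qed.

Definition axis_word J (tJ : \tr J = 0) u (s : seq (SL2 R * bool)) : SL2 R :=
  (\prod_(x <- s) (x.1 * if x.2 then axis_elt tJ u else (axis_elt tJ u)^-1))%g.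

(** The trace of axis_word before normalisation, as a polynomial in the
    parameter, so that it can be evaluated at complex points. *)
Definition axis_poly J (s : seq (SL2 R * bool)) : {poly R} :=
  let e := 1 + (1 + \det J ^+ 2) *: 'X^2 in
  let xJ := 'X *: map_mx polyC J in
  \tr (\prod_(x <- s) (map_mx polyC (SL2_mx x.1) *
    (if x.2 then e%:M + xJ else e%:M - xJ))).

Lemma rmorph_axis_poly (F : comNzRingType) (f : {rmorphism {poly R} -> F}) J s :
  f (axis_poly J s) =
  let e := 1 + f (1 + \det J ^+ 2)%:P * f 'X ^+ 2 in
  let xJ := f 'X *: map_mx (f \o polyC) J in
  \tr (\prod_(x <- s) (map_mx (f \o polyC) (SL2_mx x.1) *
    (if x.2 then e%:M + xJ else e%:M - xJ))).
Proof.
rewrite /axis_poly /= -trace_map_mx rmorph_prod; congr (\tr _).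
apply: eq_bigr => -[M b] _ /=; rewrite rmorphM /= -map_mx_comp; congr (_ * _).
have fe : f (1 + (1 + \det J ^+ 2) *: 'X^2) = 1 + f (1 + \det J ^+ 2)%:P * f 'X ^+ 2.
  by rewrite rmorphD rmorph1 -mul_polyC rmorphM rmorphXn.
by case: b; rewrite ?map_mxB ?map_mxD map_mxZ map_scalar_mx -map_mx_comp fe.
Qed.

Lemma tr_axis_word J (tJ : \tr J = 0) u s :
  \tr (SL2_mx (axis_word tJ u s)) =
  (Num.sqrt (axis_norm J u))^-1 ^+ size s * (axis_poly J s).[u].
Proof.
rewrite -horner_evalE rmorph_axis_poly /= !horner_evalE hornerC hornerX -/(axis_re J u).
rewrite -mxtraceZ; congr (\tr _).
have rE (N : 'M[R]_2) : map_mx (horner_eval u \o polyC) N = N.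
  by apply/matrixP => i j; rewrite !mxE /= horner_evalE hornerC.
rewrite /axis_word rE; elim: s => [|[M b] s IH]; first by rewrite !big_nil scale1r.
rewrite !big_cons !SL2_mulE IH rE exprS -scalerA [_ ^+ _ *: (_ * _)]scalerAr scalerAl scalerAr.
congr (_ * _ * _); case: b; first by [].
by rewrite axis_eltN /= /axis_mx axis_normN /axis_re sqrrN scaleNr.
Qed.

(** At a complex root of the norm the two factors e + uJ and e - uJ become
    singular, so that the trace of the word survives while its normalisation
    vanishes: no value of the squared trace can be taken identically. *)
Lemma axis_word_tr2_finite J (tJ : \tr J = 0) s (v : R) :
  \det J != 0 -> s != [::] ->
  cycle (transverse J) [seq (SL2_mx x.1, x.2) | x <- s] ->
  finite_set [set u | \tr (SL2_mx (axis_word tJ u s)) ^+ 2 = v]%classic.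
Proof.
move=> dJ sn cs.
pose rc : {rmorphism R -> R[i]} := real_complex R.
pose kap : R := 1 + \det J ^+ 2.
pose sigma : R[i] := sqrtC (- rc (\det J)).
pose w : R[i] := sqrtC (sigma ^+ 2 - 4 * rc kap).
have k0 : rc kap != 0.
  by rewrite fmorph_eq0 gt_eqF// ltr_pwDl// sqr_ge0.
have s0 : sigma != 0 by rewrite sqrtC_eq0 oppr_eq0 fmorph_eq0.
have s2 : sigma ^+ 2 = - rc (\det J) by rewrite sqrtCK.
have w2 : w ^+ 2 = sigma ^+ 2 - 4 * rc kap by rewrite sqrtCK.
have n2 : 2 != 0 :> R[i] by rewrite pnatr_eq0.
(* u0 is a root of axis_re = sigma u, hence of the norm. *)
pose u0 := (sigma + w) / (2 * rc kap).
have u0E : 1 + rc kap * u0 ^+ 2 = sigma * u0.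
  apply: (mulIf k0); rewrite /u0 -[LHS](_ : (4 * rc kap + (sigma + w) ^+ 2) / 4 = _); last first.
    by field; rewrite k0.
  rewrite -[RHS](_ : (2 * sigma * (sigma + w)) / 4 = _); last by field.
  by congr (_ / _); ring: w2.
have u00 : u0 != 0.
  by apply: contra_eq_neq u0E => ->; rewrite expr0n/= !mulr0 addr0 oner_eq0.
pose f : {rmorphism {poly R} -> R[i]} := horner_eval u0 \o map_poly rc.
have fC c : f c%:P = rc c by rewrite /f /= map_polyC horner_evalE hornerC.
have fX : f 'X = u0 by rewrite /f /= map_polyX horner_evalE hornerX.
pose J' := map_mx rc J.
have fmE (M : 'M[R]_2) : map_mx (f \o polyC) M = map_mx rc M.
  by apply/matrixP => i j; rewrite !mxE /= -fC.
have pE : f (axis_poly J s) = u0 ^+ size s *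
    \tr (\prod_(x <- [seq (map_mx rc (SL2_mx x.1), x.2) | x <- s])
       (x.1 * if x.2 then sigma%:M + J' else sigma%:M - J')).
  rewrite rmorph_axis_poly; cbv zeta; rewrite fC fX -/kap u0E fmE -/J' -mxtraceZ; congr (\tr _).
  elim: (s) => [|[M b] t IH]; first by rewrite /= !big_nil scale1r.
  rewrite /= !big_cons IH /= fmE exprS -scalerA [_ ^+ _ *: (_ * _)]scalerAr scalerAl scalerAr.
  congr (_ * _ * _); case: b; rewrite ?scalerBr ?scalerDr scale_scalar_mx mulrC//.
have p0 : f (axis_poly J s) != 0.
  rewrite pE mulf_neq0 ?expf_neq0//.
  apply: word_trace_neq0 => //.
  - by rewrite trace_map_mx tJ rmorph0.
  - by rewrite det_map_mx s2 opprK.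
  - by case: (s) sn.
  - by move=> _ /mapP[x _ ->] /=; rewrite det_map_mx SL2_det rmorph1.
  move: cs; rewrite !cycle_map; apply: sub_cycle => -[M b] [N c] /=.
  rewrite /transverse /= /axis_form !det_map_mx.
  have -> : J' * map_mx rc (SL2_mx N) = map_mx rc (J * SL2_mx N) by exact/esym/map_mxM.
  rewrite !trace_map_mx.
  have -> : 4 = rc 4 by rewrite rmorph_nat.
  by rewrite -!rmorphXn -!rmorphN -!rmorphM -!rmorphD !fmorph_eq0.
pose d : {poly R} := (1 + kap *: 'X^2) ^+ 2 + \det J *: 'X^2.
have dE u : d.[u] = axis_norm J u.
  by rewrite /d !hornerE /= /axis_norm /axis_re -/kap; ring.
have fd : f d = 0.
  have fcX c : f (c *: 'X^2) = rc c * u0 ^+ 2.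
    by rewrite -mul_polyC (rmorphM f) fC; congr (_ * _); rewrite (rmorphXn f) fX.
  rewrite /d (rmorphD f) fcX (rmorphXn f) (rmorphD f) (rmorph1 f) fcX u0E.
  by rewrite exprMn s2 mulNr addNr.
pose q := axis_poly J s ^+ 2 - v%:P * d ^+ size s.
have q0 : q != 0.
  apply: contraNneq p0 => q0; rewrite -sqrf_eq0 -rmorphXn.
  have -> : axis_poly J s ^+ 2 = v%:P * d ^+ size s by apply/eqP; rewrite -subr_eq0 -/q q0.
  by rewrite rmorphM rmorphXn fd expr0n size_eq0 (negPf sn) mulr0.
apply: sub_finite_set (finite_roots q0) => u /= Bu.
rewrite /root /q hornerD hornerN [(v%:P * _).[u]]hornerM hornerC !horner_exp dE -Bu tr_axis_word.
have d0 := axis_norm_gt0 J u; have d1 : axis_norm J u != 0 by rewrite gt_eqF.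
rewrite exprMn -exprM mulnC exprM exprVn sqr_sqrtr ?ltW// mulrAC -exprMn mulVf//.
by rewrite expr1n mul1r subrr.
Qed.
End AxisSubgroup.

(** * Finding an axis *)

Lemma ex_not_countable (R : realType) (B : set R) :
  countable B -> exists2 x, 0 < x & ~ B x.
Proof.
move=> cB; apply: contrapT => nB.
have : (`]0%R, 1%R[%classic : set R) `<=` B.
  by move=> x /=; rewrite in_itv /= => /andP[x0 _]; apply: contrapT => Bx; apply: nB; exists x.
move=> /subset_card_le /sub_countable /(_ cB) /countable_lebesgue_measure0.
rewrite lebesgue_measure_itv /= lte01 oppr0 adde0 => /eqP.
by rewrite eqe oner_eq0.
Qed.

Section Morphisms.
Variables (G H : groupType) (f : {multiplicative G -> H}).
Local Open Scope group_scope.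

Lemma mmorph1 : f 1 = 1.
Proof. by apply: (mulgI (f 1)); rewrite -gmulfM !mulg1. Qed.

Lemma mmorphV x : f x^-1 = (f x)^-1.
Proof. by apply: (mulgI (f x)); rewrite -gmulfM !mulgV mmorph1. Qed.

Lemma mmorphJ x y : f (x ^ y) = f x ^ f y.
Proof. by rewrite /conjg !gmulfM mmorphV. Qed.

Lemma mmorphX x n : f (x ^+ n) = f x ^+ n.
Proof. by elim: n => [|n IH]; rewrite ?mmorph1// !expgS gmulfM IH. Qed.

End Morphisms.

Section AxisExists.
Variable R : realType.
Implicit Types (J : 'M[R]_2) (M N : SL2 R).

Lemma piM M N : \pi_(PSL2 R) (M * N)%g = (\pi_(PSL2 R) M * \pi_(PSL2 R) N)%g :> PSL2 R.
Proof. by rewrite -PSL2_mul_pi. Qed.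

Lemma piV M : \pi_(PSL2 R) M^-1%g = (\pi_(PSL2 R) M)^-1%g :> PSL2 R.
Proof. by rewrite -PSL2_inv_pi. Qed.

Lemma tr_commutator M N :
  \tr (SL2_mx (M * N * (N * M)^-1)%g) =
  2 - \det (SL2_mx M * SL2_mx N - SL2_mx N * SL2_mx M).
Proof.
have YY : SL2_mx (N * M)%g * SL2_mx (N * M)^-1%g = 1.
  by rewrite -SL2_mulE mulgV.
rewrite -!SL2_mulE [SL2_mx (M * N * _)%g]SL2_mulE.
have := SL2_det (N * M)%g; have := SL2_det (M * N)%g.
move: (SL2_mx (M * N)%g) (SL2_mx (N * M)%g) (SL2_mx (N * M)^-1%g) YY => X Y Y' YY dX dY.
have [e00 e01 e10 e11] := inv2E dY YY.
move: dX dY; rewrite trace2 !det2 !mul2E e00 e01 e10 e11 !mxE => dX dY.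
by rewrite -[2](_ : 1 + 1 = _)// -{1}dX -dY; ring.
Qed.

Lemma anticommute_trace0 M N :
  SL2_mx M * SL2_mx N = - (SL2_mx N * SL2_mx M) -> \tr (SL2_mx M) = 0.
Proof.
move=> MN; have : \tr (SL2_mx M) = - \tr (SL2_mx M).
  rewrite -[M in LHS](mulgK N) !SL2_mulE MN mulNr raddfN /=; congr (- _).
  by rewrite [LHS]mxtrace_mulC; congr (\tr _); exact: (mulKmx (SL2_unit N)).
by clear MN => h; lra.
Qed.

Lemma SL2_not_anticommute M N : SL2_mx M * SL2_mx N <> - (SL2_mx N * SL2_mx M).
Proof.
move=> MN; have tM := anticommute_trace0 MN.
have tN : \tr (SL2_mx N) = 0 by apply: (@anticommute_trace0 N M); rewrite MN opprK.
have := SL2_det M; have := SL2_det N.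
have : (SL2_mx M * SL2_mx N) 0 0 = - (SL2_mx N * SL2_mx M) 0 0 by rewrite MN mxE.
rewrite !mul2E !det2; move: tM tN; rewrite !trace2; clear MN; move: (SL2_mx M) (SL2_mx N) => X Y.
move: (X 0 0) (X 0 1) (X 1 0) (X 1 1) (Y 0 0) (Y 0 1) (Y 1 0) (Y 1 1).
move=> a b c d p q r s ad ps e00 dY dX.
have {}ad : d = - a by lra.
have {}ps : s = - p by lra.
subst d s.
have E : (q * c - b * r) ^+ 2 = - 4 - 4 * a ^+ 2 - 4 * p ^+ 2.
  rewrite (_ : (q * c - b * r) ^+ 2 = (q * c + b * r) ^+ 2 - 4 * (b * c) * (q * r)); last by ring.
  rewrite (_ : q * c + b * r = - (2 * a * p)); last by lra.
  rewrite (_ : b * c = - (1 + a ^+ 2)); last by rewrite -dX; ring.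
  by rewrite (_ : q * r = - (1 + p ^+ 2)); [ring|rewrite -dY; ring].
have := sqr_ge0 (q * c - b * r); rewrite E.
by have := sqr_ge0 a; have := sqr_ge0 p; lra.
Qed.

(** Elements commuting up to sign commute: the sign would make the two
    matrices generate the quaternions inside the real 2 by 2 matrices. *)
Lemma pi_commute M N : commute (\pi_(PSL2 R) M : PSL2 R) (\pi_(PSL2 R) N) ->
  SL2_mx M * SL2_mx N = SL2_mx N * SL2_mx M.
Proof.
rewrite /commute -!piM => /PSL2_eqP[/(congr1 (@SL2_mx R))//|].
by move=> /(congr1 (@SL2_mx R)) /SL2_not_anticommute.
Qed.

Definition pmx (p : PSL2 R) : 'M[R]_2 := SL2_mx (repr p).

(** J spans the Lie algebra of a one-parameter subgroup containing the image of C,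
    and the elements outside C move both of its (possibly complex) fixed points
    off themselves and off each other. *)
Definition is_axis (A : groupType) (C : groupClosed A)
    (rho : {multiplicative A -> PSL2 R}) J :=
  [/\ \tr J = 0, \det J != 0,
    forall c, c \in C -> J * pmx (rho c) = pmx (rho c) * J &
    forall a, a \notin C ->
      axis_form J (pmx (rho a)) != 0 /\ axis_form J (pmx (rho a)) + 4 * \det J != 0].

Section WithRepresentation.
Variables (A : groupType) (C : groupClosed A) (rho : {multiplicative A -> PSL2 R}).
Hypotheses (rho_inj : faithful rho) (rho_pf : parabolic_free rho).

Lemma tr2_eq4 g : tr2 (rho g) = 4 -> g = 1%g.
Proof.
move=> t4; apply: rho_inj; rewrite mmorph1; apply: contrapT => n1.
exact: (rho_pf (g := g)).
Qed.

Lemma rho_pmx g : \pi_(PSL2 R) (repr (rho g)) = rho g. Proof. exact: reprK. Qed.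

(** A commutator of trace 2 is parabolic or trivial, hence trivial here. *)
Lemma det_commutator0 g h M N :
  \pi_(PSL2 R) M = rho g -> \pi_(PSL2 R) N = rho h ->
  \det (SL2_mx M * SL2_mx N - SL2_mx N * SL2_mx M) = 0 -> commute g h.
Proof.
move=> Mg Nh d0; have := tr_commutator M N; rewrite d0 subr0 => t2.
apply/(@divg1_eq A)/tr2_eq4.
have E : rho (g * h * (h * g)^-1)%g = \pi_(PSL2 R) (M * N * (N * M)^-1)%g.
  rewrite [RHS]piM piV (piM M N) (piM N M) Mg Nh.
  by rewrite (@gmulfM _ _ rho) mmorphV !(@gmulfM _ _ rho).
by rewrite E tr2_pi t2 -natrX.
Qed.

(** If an element a outside C degenerated with respect to the axis of c, then
    c ^ a and c would share a fixed point; their commutator would have trace 2,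
    so they would commute, and malnormality forbids this. *)
Lemma axis_of_subgroup c : abelian_subgroup C -> malnormal C -> c \in C -> c != 1%g ->
  exists J, is_axis C rho J.
Proof.
move=> abC mC cC c1; pose t := \tr (pmx (rho c)).
have t4 : t ^+ 2 != 4 by apply: contraNneq c1 => /tr2_eq4 ->.
pose J := pmx (rho c) - (t / 2)%:M.
have tJ : \tr J = 0 by rewrite raddfB /= mxtrace_scalar -/t; field.
have dJ : \det J = 1 - t ^+ 2 / 4.
  have := SL2_det (repr (rho c)); rewrite -/(pmx (rho c)) /J /t !det2 !mxE/= trace2.
  by move: (pmx (rho c)) => X dX; rewrite -[X in _ = X - _]dX; field.
have sC (X : 'M[R]_2) : (t / 2)%:M * X = X * (t / 2)%:M by exact/esym/scalar_mxC.
have JM g : pmx (rho g) * J - J * pmx (rho g) =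
    pmx (rho g) * pmx (rho c) - pmx (rho c) * pmx (rho g).
  by rewrite /J mulrBr mulrBl sC opprB addrA subrK.
exists J; split=> //.
- by rewrite dJ; apply: contraNneq t4 => /eqP; rewrite subr_eq0 => /eqP t1; apply/eqP; lra.
- move=> d dC; apply/esym/eqP; rewrite -subr_eq0 JM subr_eq0; apply/eqP.
  apply: pi_commute; rewrite !rho_pmx; apply: gmulf_commute; exact: abC.
move=> a aC; set phi := axis_form J _; set M := repr (rho a) in phi *.
suff : phi * (- 4 * \det J - phi) != 0.
  rewrite mulf_eq0 negb_or => /andP[p0 p1]; split=> //; apply: contraNneq p1 => p1.
  by apply/eqP; lra.
have MV : SL2_mx M * SL2_mx M^-1%g = 1 by rewrite -SL2_mulE mulgV.
have VM : SL2_mx M^-1%g * SL2_mx M = 1 by rewrite -SL2_mulE mulVg.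
rewrite /phi -(axis_form_conj tJ (SL2_det M) MV); apply/negP => /eqP d0.
have cca : commute (c ^ a)%g c.
  apply: (@det_commutator0 _ _ (M^-1 * repr (rho c) * M)%g (repr (rho c))).
  - rewrite !piM piV /M !rho_pmx /conjg mulgA (@gmulfM _ _ rho (_ * _)%g) (@gmulfM _ _ rho).
    by rewrite mmorphV.
  - exact: rho_pmx.
  rewrite -d0 !SL2_mulE -/(pmx (rho c)); congr (\det _).
  have cJ : pmx (rho c) = J + (t / 2)%:M by rewrite subrK.
  have NE : SL2_mx M^-1%g * (J + (t / 2)%:M) * SL2_mx M =
      SL2_mx M^-1%g * J * SL2_mx M + (t / 2)%:M.
    by rewrite mulrDr mulrDl -(sC (SL2_mx M^-1%g)) -(mulrA (t / 2)%:M) VM mulr1.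
  rewrite cJ NE.
  move: (_ * J * _) (_%:M) sC => K S sC.
  rewrite !(mulrDr, mulrDl) -!sC.
  by apply/matrixP => i j; rewrite !mxE; ring.
have [cC'|cC'] := boolP ((c ^ a)%g \in C).
  have : ([set (x ^ a)%g | x in [set` C]] `&` [set` C]) (c ^ a)%g by split=> //; exists c.
  by rewrite (mC _ aC) /= => /eqP; rewrite conjg_eq1 (negPf c1).
have : ([set (x ^ (c ^ a))%g | x in [set` C]] `&` [set` C]) c.
  by split=> //; exists c => //; apply/conjg_fixP/commgP.
by rewrite (mC _ cC') /= => /eqP; rewrite (negPf c1).
Qed.

(** When C is trivial any generic axis will do: among the infinitesimal rotations
    about the points of the imaginary axis, a given nontrivial element excludes
    finitely many. *)
Lemma axis_trivial : countable [set: A] -> (forall c, c \in C -> c = 1%g) ->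
  exists J, is_axis C rho J.
Proof.
move=> cA C1.
(* p M 0 and p M 4 are the two quantities that must not vanish, as polynomials
   in the upper right entry of J. *)
pose p (M : SL2 R) (k : R) : {poly R} :=
  (k - \tr (SL2_mx M) ^+ 2) *: 'X - (SL2_mx M 1 0 *: 'X - (SL2_mx M 0 1)%:P) ^+ 2.
pose bad a := [set x | root (p (repr (rho a)) 0) x] `|`
  [set x | root (p (repr (rho a)) 4) x].
have fin a : a != 1%g -> countable (bad a).
  move=> a1; apply: finite_set_countable; rewrite finite_setU.
  have pE k : p (repr (rho a)) k = 0 ->
      [/\ \tr (pmx (rho a)) ^+ 2 = k, pmx (rho a) 1 0 = 0 & pmx (rho a) 0 1 = 0].
    move=> p0; have pw w : (k - \tr (pmx (rho a)) ^+ 2) * w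
        - (pmx (rho a) 1 0 * w - pmx (rho a) 0 1) ^+ 2 = 0.
      by rewrite -[RHS](horner0 w) -p0 /p !hornerE.
    move: (pw 0) (pw 1) (pw (-1)); move: (\tr _ ^+ 2) (_ 1 0) (_ 0 1) => t2 r q e0 e1 e2.
    have : q ^+ 2 = 0 by rewrite -[RHS]oppr0 -e0; ring.
    have : r ^+ 2 = 0 by nra.
    move=> /eqP; rewrite sqrf_eq0 => /eqP r0 /eqP; rewrite sqrf_eq0 => /eqP q0.
    by split=> //; move: e1; rewrite r0 q0; lra.
  split; apply: finite_roots; apply/eqP => /pE[t2 r0 q0].
    have := SL2_det (repr (rho a)); move: t2 r0 q0; rewrite -/(pmx _) trace2 det2.
    move: (pmx (rho a)) => X t2 -> ->; rewrite mul0r subr0 => d1.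
    have := sqr_ge0 (X 0 0); have := sqr_ge0 (X 1 1); nra.
  by move: a1; rewrite (tr2_eq4 t2) eqxx.
have /ex_not_countable[w w0 wB] : countable (\bigcup_(a in [set a | a != 1%g]) bad a).
  by apply: bigcup_countable => //; apply: sub_countable cA; exact/subset_card_le/subsetT.
pose J : 'M[R]_2 := \matrix_(i, j) (if i == 0 then (if j == 0 then 0 else w)
   else (if j == 0 then - 1 else 0)).
exists J.
have J00 : J 0 0 = 0 by rewrite mxE.
have J01 : J 0 1 = w by rewrite mxE.
have J10 : J 1 0 = - 1 by rewrite mxE.
have J11 : J 1 1 = 0 by rewrite mxE.
clearbody J.
have dJ : \det J = w by rewrite det2 J00 J01 J10 J11; ring.
split.
- by rewrite trace2 J00 J11 addr0.
- by rewrite dJ gt_eqF.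
- move=> c /C1 ->; rewrite /pmx mmorph1.
  suff [->|->] : repr (1%g : PSL2 R) = 1%g \/
      repr (1%g : PSL2 R) = SL2_opp (1%g : SL2 R).
  + by rewrite mulr1 mul1r.
  + by rewrite /= mulrN mulNr mulr1 mul1r.
  by apply: PSL2_repr.
move=> a aC; have a1 : a != 1%g by apply: contraNneq aC => ->; exact: gpred1.
have nb : ~ bad a w by move=> b; apply: wB; exists a.
have tJM : \tr (J * pmx (rho a)) = w * pmx (rho a) 1 0 - pmx (rho a) 0 1.
  by rewrite trace2 !mul2E J00 J01 J10 J11; ring.
rewrite /axis_form dJ tJM; split; apply/eqP => e; apply: nb; [left|right];
  rewrite /= /root /p !hornerE -/(pmx _) -e; apply/eqP; ring.
Qed.

Lemma axis_exists : countable [set: A] -> abelian_subgroup C -> malnormal C ->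
  exists J, is_axis C rho J.
Proof.
move=> cA abC mC.
have [[c cC c1]|C1] := pselect (exists2 c, c \in C & c != 1%g).
  exact: axis_of_subgroup cC c1.
apply: axis_trivial => // c cC; apply/eqP/negPn/negP => c1; apply: C1.
by exists c.
Qed.
End WithRepresentation.
End AxisExists.

Close Scope ring_scope.
Local Open Scope group_scope.

(** * Cyclic reduction and amalgams *)

Section CyclicWords.
Variables (T : eqType) (G : groupType).
Implicit Types (r : rel T) (s : seq T).

Lemma not_path r x p : ~~ path r x p ->
  exists p1 u v p2, x :: p = p1 ++ u :: v :: p2 /\ ~~ r u v.
Proof.
elim: p x => //= y p IH x; rewrite negb_and => /orP[xy|/IH[p1 [u [v [p2 [-> uv]]]]]].
  by exists [::], x, y, p.
by exists (x :: p1), u, v, p2.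
Qed.

(** A cyclic word violating r has a violation in the first two places of one of
    its rotations, where a reduction can be performed. *)
Lemma not_cycle r s : ~~ cycle r s ->
  (exists2 x, s = [:: x] & ~~ r x x) \/
  exists n x y s', rot n s = x :: y :: s' /\ ~~ r x y.
Proof.
case: s => // x p /= /not_path[p1 [u [v [p2 [E uv]]]]].
case/lastP: p2 E => [|p2 w].
  rewrite -rcons_cons -[u :: _]/([:: u] ++ [:: v]) catA cats1 => /rcons_inj[E xv].
  case: p1 E => [[xu ->]|y p1 /= [_ ->]].
    by left; exists x => //; rewrite {1}xu xv.
  right; exists (size p1).+1, u, x, p1; split; last by rewrite xv.
  by rewrite -cat_cons (rot_size_cat (x :: p1)).
rewrite -rcons_cons -!rcons_cons -rcons_cat => /rcons_inj[E _].
right; exists (size p1), u, v, (p2 ++ p1); split=> //.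
by rewrite E rot_size_cat.
Qed.

Definition conjugate (x y : G) := exists h, x ^ h = y.

Lemma conjugate_refl x : conjugate x x. Proof. by exists 1; rewrite conjg1. Qed.

Lemma conjugate_trans y x z : conjugate x y -> conjugate y z -> conjugate x z.
Proof. by move=> [h <-] [k <-]; exists (h * k); rewrite conjgM. Qed.

Lemma conjugate_swap x y : conjugate (x * y) (y * x).
Proof. by exists x; rewrite /conjg !mulgA mulVg mul1g. Qed.

Lemma conjugate_rot n s (F : T -> G) :
  conjugate (\prod_(x <- s) F x) (\prod_(x <- rot n s) F x).
Proof. rewrite -{1}(cat_take_drop n s) /rot !big_cat; exact: conjugate_swap. Qed.

End CyclicWords.

Section Reduction.
Variables (A : groupType) (C : groupClosed A) (L : groupType).
Implicit Types (x y : A * bool) (s : seq (A * bool)).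

Section HNN.
Variables (iota : {multiplicative A -> L}) (t : L).
Hypothesis tC : forall c, c \in C -> commute (iota c) t.

Definition hnn_prod s : L := \prod_(x <- s) (iota x.1 * if x.2 then t else t^-1).

Definition hnn_reduced : rel (A * bool) := fun x y => (y.1 \in C) ==> (x.2 == y.2).

(** Britton reduction: as t commutes with C, a pinch t c t^-1 collapses to c. *)
Lemma hnn_cyclic_reduction s :
  (exists a, conjugate (hnn_prod s) (iota a)) \/
  exists2 s', s' != [::] & cycle hnn_reduced s' /\ conjugate (hnn_prod s) (hnn_prod s').
Proof.
have [n] := ubnP (size s); elim: n s => // n IH s; rewrite ltnS => sn.
have [->|s0] := eqVneq s [::].
  by left; exists 1; rewrite /hnn_prod big_nil mmorph1; exact: conjugate_refl.
have [cs|/not_cycle[[x _]|]] := boolP (cycle hnn_reduced s).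
- by right; exists s => //; split=> //; exact: conjugate_refl.
- by rewrite /hnn_reduced eqxx implybT.
move=> [m [[a e] [[b e'] [s' [rE]]]]]; rewrite /hnn_reduced negb_imply /= => /andP[bC ee'].
have cR := conjugate_rot m s (fun x => iota x.1 * if x.2 then t else t^-1).
have pinch : iota a * (if e then t else t^-1) * (iota b * if e' then t else t^-1) =
    iota (a * b).
  rewrite gmulfM -mulgA; congr (_ * _); have ct := tC bC.
  by clear rE; case: e e' ee' => -[]//= _; [rewrite mulgA -ct mulgK|rewrite ct mulKg].
move: cR; rewrite rE !big_cons mulgA pinch /= => cR.
case: s' rE cR => [_|[d e''] s' rE]; first by rewrite big_nil mulg1; left; exists (a * b).
rewrite big_cons /= !mulgA -gmulfM => cR.
have /IH : (size (((a * b * d)%g, e'') :: s') < n)%N.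
  by apply: leq_trans sn; rewrite -(size_rot m s) rE.
by move=> [[g cg]|[s'' ? [? cg]]]; [left; exists g|right; exists s'' => //; split=> //];
  apply: conjugate_trans cR _; move: cg; rewrite /hnn_prod big_cons.
Qed.
End HNN.

Section Double.
Variable iota : bool -> {multiplicative A -> L}.
Hypothesis iotaC : forall c, c \in C -> iota true c = iota false c.

Definition double_prod s : L := \prod_(x <- s) iota x.2 x.1.

Definition double_reduced : rel (A * bool) := fun x y => (x.2 != y.2) && (y.1 \notin C).

(** Two consecutive letters merge when they lie in the same copy, or when the
    second one lies in C and thus in both copies. *)
Lemma double_cyclic_reduction s :
  (exists b a, conjugate (double_prod s) (iota b a)) \/
  exists2 s', s' != [::] &
    cycle double_reduced s' /\ conjugate (double_prod s) (double_prod s').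
Proof.
have [n] := ubnP (size s); elim: n s => // n IH s; rewrite ltnS => sn.
have [->|s0] := eqVneq s [::].
  by left; exists true, 1; rewrite /double_prod big_nil mmorph1; exact: conjugate_refl.
have [cs|/not_cycle[[x -> _]|]] := boolP (cycle double_reduced s).
- by right; exists s => //; split=> //; exact: conjugate_refl.
- by left; exists x.2, x.1; rewrite /double_prod big_seq1; exact: conjugate_refl.
move=> [m [[a e] [[b e'] [s' [rE]]]]]; rewrite /double_reduced negb_and !negbK /= => ebC.
have cR := conjugate_rot m s (fun x => iota x.2 x.1).
have merge : iota e a * iota e' b = iota e (a * b).
  rewrite gmulfM; congr (_ * _); case/orP: ebC => [/eqP->//|/iotaC].
  by case: e e' {rE} => -[].
move: cR; rewrite rE !big_cons mulgA merge /= => cR.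
have /IH : (size (((a * b)%g, e) :: s') < n)%N.
  by apply: leq_trans sn; rewrite -(size_rot m s) rE.
by move=> [[g [h cg]]|[s'' ? [? cg]]];
  [left; exists g, h|right; exists s'' => //; split=> //];
  apply: conjugate_trans cR _; move: cg; rewrite /double_prod big_cons.
Qed.
End Double.
End Reduction.

Section AmalgamMap.
Variables (K G H : groupType) (f : {multiplicative K -> G}) (g : {multiplicative K -> H}).
Local Notation L := (amalgam f g).

Definition amalg_inl (x : G) : L := \pi_L [:: inl x].
Definition amalg_inr (y : H) : L := \pi_L [:: inr y].

Lemma amalg_piM v w : \pi_L (v ++ w) = \pi_L v * \pi_L w :> L.
Proof. by rewrite -amalgam_mul_pi. Qed.

Fact amalg_inlM : {morph amalg_inl : x y / x * y}.
Proof. by move=> x y; rewrite -amalg_piM; apply/esym/amalgam_eqP/AmalgMulL. Qed.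
Fact amalg_inrM : {morph amalg_inr : x y / x * y}.
Proof. by move=> x y; rewrite -amalg_piM; apply/esym/amalgam_eqP/AmalgMulR. Qed.
HB.instance Definition _ := isMultiplicative.Build G L amalg_inl amalg_inlM.
HB.instance Definition _ := isMultiplicative.Build H L amalg_inr amalg_inrM.

Lemma amalg_glue k : amalg_inl (f k) = amalg_inr (g k).
Proof. exact/amalgam_eqP/AmalgGlue. Qed.

Lemma amalg_ind (P : L -> Prop) : P 1 ->
  (forall x z, P z -> P (amalg_inl x * z)) -> (forall y z, P z -> P (amalg_inr y * z)) ->
  forall z, P z.
Proof.
move=> P1 Pl Pr z; have [w ->] := amalgamP z; elim: w => [//|[x|y] w IH].
  by rewrite -cat1s amalg_piM; exact: Pl.
by rewrite -cat1s amalg_piM; exact: Pr.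
Qed.

Section Universal.
Variables (M : groupType) (a : {multiplicative G -> M}) (b : {multiplicative H -> M}).
Hypothesis ab : forall k, a (f k) = b (g k).

Definition word_eval (w : seq (G + H)) : M :=
  \prod_(x <- w) match x with inl x => a x | inr y => b y end.

Lemma word_eval_rel v w : amalg_rel f g v w -> word_eval v = word_eval w.
Proof.
rewrite /word_eval; elim=> {v w} //.
- by move=> u v w _ -> _ ->.
- by move=> u v u' v' _ IH1 _ IH2; rewrite !big_cat /= IH1 IH2.
- by move=> x y; rewrite !big_cons !big_nil !mulg1 gmulfM.
- by move=> x y; rewrite !big_cons !big_nil !mulg1 gmulfM.
- by rewrite big_seq1 big_nil mmorph1.
- by rewrite big_seq1 big_nil mmorph1.
- by move=> k; rewrite !big_seq1.
Qed.

(** The compatibility is an argument, rather than a condition of the section, so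
    that the instance below applies to the map itself. *)
Definition amalg_map of (forall k, a (f k) = b (g k)) := fun x : L => word_eval (repr x).

Lemma amalg_map_pi w : amalg_map ab (\pi_L w) = word_eval w.
Proof. exact/word_eval_rel/amalgam_repr. Qed.

Fact amalg_mapM : {morph amalg_map ab : x y / x * y}.
Proof.
move=> x y; have [[v ->] [w ->]] := (amalgamP x, amalgamP y).
by rewrite -amalg_piM !amalg_map_pi /word_eval big_cat.
Qed.
HB.instance Definition _ := isMultiplicative.Build L M (amalg_map ab) amalg_mapM.

Lemma amalg_map_inl x : amalg_map ab (amalg_inl x) = a x.
Proof. by rewrite amalg_map_pi /word_eval big_seq1. Qed.
Lemma amalg_map_inr y : amalg_map ab (amalg_inr y) = b y.
Proof. by rewrite amalg_map_pi /word_eval big_seq1. Qed.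
End Universal.
End AmalgamMap.

(** * Integer powers, generators, and the two amalgams *)

Section IntegerPowers.
Variable M : groupType.
Implicit Types z : M.

Definition zpow z (n : int) : M :=
  match n with Posz m => z ^+ m | Negz m => z ^- m.+1 end.

Lemma zpowS z n : zpow z (n + 1)%R = zpow z n * z.
Proof.
case: n => n; first by rewrite -[(Posz n + 1)%R]/(Posz (n + 1)) addn1 /= expgSr.
have -> : (Negz n + 1 = - Posz n)%R by rewrite NegzE -addn1 PoszD opprD subrK.
case: n => [|n]; first by rewrite oppr0 /= mulVg.
by rewrite -NegzE /= [in RHS]expgS invgM mulgVK.
Qed.

Lemma zpowN1 z n : zpow z (n - 1)%R = zpow z n * z^-1.
Proof. by rewrite -[in RHS](subrK 1%R n) zpowS mulgK. Qed.

Lemma zpow_unique z (F : int -> M) : F 0%R = 1 ->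
  (forall n, F (n + 1)%R = F n * z) -> F =1 zpow z.
Proof.
move=> F0 FS n; have FN m : F (m - 1)%R = F m * z^-1.
  by rewrite -[in RHS](subrK 1%R m) FS mulgK.
elim/int_rec: n => [//|n IH|n IH]; first by rewrite -addn1 PoszD FS IH zpowS.
by rewrite -addn1 PoszD opprD FN IH zpowN1.
Qed.

Lemma zpowD z m n : zpow z (m + n)%R = zpow z m * zpow z n.
Proof.
apply: (mulgI (zpow z m)^-1); rewrite mulKg.
apply: (zpow_unique (F := fun n => (zpow z m)^-1 * zpow z (m + n)%R)).
  by rewrite addr0 mulVg.
by move=> k; rewrite addrA zpowS mulgA.
Qed.

Lemma commute_zpow x z n : commute x z -> commute x (zpow z n).
Proof. by move=> xz; case: n => n; [|apply: commuteV]; apply: commuteX. Qed.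

End IntegerPowers.

Section FiniteGeneration.
Local Open Scope classical_set_scope.

Section Preimage.
Variables (G H : groupType) (f : {multiplicative G -> H}) (S : groupClosed H).
Definition preimage_pred : {pred G} := [pred x | f x \in S].
Fact preimageM : mulg_closed preimage_pred.
Proof. by move=> x y; rewrite !inE gmulfM => *; exact: gpredM. Qed.
Fact preimage1 : (1 : G) \in preimage_pred.
Proof. by rewrite inE mmorph1 gpred1. Qed.
Fact preimageV : invg_closed preimage_pred.
Proof. by move=> x; rewrite !inE mmorphV gpredV. Qed.
HB.instance Definition _ := isMulClosed.Build G preimage_pred preimageM.
HB.instance Definition _ := isMul1Closed.Build G preimage_pred preimage1.
HB.instance Definition _ := isInvClosed.Build G preimage_pred preimageV.
End Preimage.

Lemma preimage_generated (G H : groupType) (f : {multiplicative G -> H}) (s : seq G)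
    (S : groupClosed H) :
  (forall T : groupClosed G, {subset s <= T} -> forall x, x \in T) ->
  {subset [seq f x | x <- s] <= S} -> forall x, f x \in S.
Proof.
move=> sG sS x; have := sG (preimage_pred f S).
apply=> y ys; rewrite inE; apply: sS; exact: map_f.
Qed.

Section Words.
Variables (L : groupType) (s : seq L).
Definition gen_word (w : seq (bool * nat)) : L :=
  \prod_(i <- w) if i.1 then nth 1 s i.2 else (nth 1 s i.2)^-1.
Definition gen_pred : {pred L} := [pred x | `[< exists w, gen_word w = x >]].
Fact gen_predM : mulg_closed gen_pred.
Proof.
move=> _ _ /asboolP[v <-] /asboolP[w <-]; apply/asboolP; exists (v ++ w).
by rewrite /gen_word big_cat.
Qed.
Fact gen_pred1 : (1 : L) \in gen_pred.
Proof. by apply/asboolP; exists [::]; rewrite /gen_word big_nil. Qed.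
Fact gen_predV : invg_closed gen_pred.
Proof.
move=> _ /asboolP[w <-]; apply/asboolP; exists (rev [seq (~~ i.1, i.2) | i <- w]).
rewrite /gen_word; elim: w => [|[b n] w IH]; first by rewrite !big_nil invg1.
rewrite /= rev_cons -cats1 big_cat IH big_seq1 big_cons invgM /=; congr (_ * _).
by case: b => //=; rewrite invgK.
Qed.
HB.instance Definition _ := isMulClosed.Build L gen_pred gen_predM.
HB.instance Definition _ := isMul1Closed.Build L gen_pred gen_pred1.
HB.instance Definition _ := isInvClosed.Build L gen_pred gen_predV.
End Words.

Lemma finitely_generated_countable (L : groupType) :
  finitely_generated L -> countable [set: L].
Proof.
move=> [s sL]; have : [set: L] `<=` range (gen_word s).
  move=> x _; have /asboolP[w <-] : x \in gen_pred s; last by exists w.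
  apply: sL => y ys; apply/asboolP; exists [:: (true, index y s)].
  by rewrite /gen_word big_seq1 /= nth_index.
move=> /subset_card_le /sub_countable; apply.
by apply: sub_countable (card_image_le _ _) _; exact: countableP.
Qed.

End FiniteGeneration.

Section HNNGroup.
Variables (A : groupType) (C : groupClosed A).
Local Notation L := (HNN_along C).

Definition hnn_incl : {multiplicative A -> L} :=
  @amalg_inl _ _ _ (@sub_incl A C) (@sub_pair A C).
Definition hnn_pair : {multiplicative (subgroup_of C * Zgroup)%type -> L} :=
  @amalg_inr _ _ _ (@sub_incl A C) (@sub_pair A C).
Definition hnn_letter : L := hnn_pair (1, (1%R : int)).

Lemma hnn_pairE c n : hnn_pair (c, n) = hnn_incl (sub_incl c) * zpow hnn_letter n.
Proof.
have -> : (c, n) = (c, 1) * (1, n) by congr (_, _); rewrite ?mulg1 ?mul1g.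
rewrite gmulfM; congr (_ * _); first exact/esym/amalg_glue.
apply: (zpow_unique (F := fun n => hnn_pair (1, n))); first exact: mmorph1.
by move=> m; rewrite /hnn_letter -gmulfM; congr (hnn_pair _); congr (_, _); rewrite mulg1.
Qed.

Lemma hnn_letterC c : c \in C -> commute (hnn_incl c) hnn_letter.
Proof.
move=> cC; have -> : hnn_incl c = hnn_pair (sub_pair (SubgroupOf cC)).
  exact: (amalg_glue _ _ (SubgroupOf cC)).
rewrite /commute -!gmulfM; congr (hnn_pair _); congr (_, _); by rewrite mulg1 mul1g.
Qed.

Lemma hnn_ind (P : L -> Prop) : P 1 -> (forall a x, P x -> P (hnn_incl a * x)) ->
  (forall x, P x -> P (hnn_letter * x)) -> (forall x, P x -> P (hnn_letter^-1 * x)) ->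
  forall x, P x.
Proof.
move=> P1 Pa Pt PtV; apply: amalg_ind => // -[c n] x Px.
change (P (hnn_pair (c, n) * x)); rewrite hnn_pairE -mulgA; apply: Pa.
elim/int_rec: n => [|n IH|n IH]; first by rewrite mul1g.
  by rewrite -addn1 PoszD addrC zpowD -mulgA; exact: Pt.
by rewrite -addn1 PoszD opprD addrC zpowD -mulgA; exact: PtV.
Qed.

Lemma hnn_normal x : exists s a, x = hnn_prod hnn_incl hnn_letter s * hnn_incl a.
Proof.
elim/hnn_ind: x => [|a x [[|[b e] s] [d ->]]|x [s [d ->]]|x [s [d ->]]].
- by exists [::], 1; rewrite /hnn_prod big_nil mmorph1 mulg1.
- by exists [::], (a * d); rewrite /hnn_prod !big_nil !mul1g gmulfM.
- by exists ((a * b, e) :: s), d; rewrite /hnn_prod !big_cons /= gmulfM !mulgA.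
- by exists ((1, true) :: s), d; rewrite /hnn_prod !big_cons /= mmorph1 mul1g !mulgA.
- by exists ((1, false) :: s), d; rewrite /hnn_prod !big_cons /= mmorph1 mul1g !mulgA.
Qed.

Lemma hnn_conjugate x :
  exists s, (exists a, conjugate x (hnn_incl a)) \/
    [/\ s != [::], cycle (hnn_reduced C) s &
        conjugate x (hnn_prod hnn_incl hnn_letter s)].
Proof.
have [[|[b e] s] [d ->]] := hnn_normal x.
  exists [::]; left; exists d; rewrite /hnn_prod big_nil mul1g.
  exact: conjugate_refl.
have := hnn_cyclic_reduction hnn_letterC ((d * b, e) :: s).
have : conjugate (hnn_prod hnn_incl hnn_letter ((b, e) :: s) * hnn_incl d)
    (hnn_prod hnn_incl hnn_letter ((d * b, e) :: s)).
  rewrite (_ : hnn_prod _ _ ((d * b, e) :: s) =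
      hnn_incl d * hnn_prod hnn_incl hnn_letter ((b, e) :: s)).
    exact: conjugate_swap.
  by rewrite /hnn_prod !big_cons /= gmulfM !mulgA.
move=> c [[a ac]|[s' s'0 [s'c ac]]].
  by exists [::]; left; exists a; exact: conjugate_trans c ac.
by exists s'; right; split=> //; exact: conjugate_trans c ac.
Qed.

Lemma hnn_finitely_generated : finitely_generated A -> finitely_generated L.
Proof.
move=> [s sA]; exists (hnn_letter :: [seq hnn_incl a | a <- s]) => S sS.
have tS : hnn_letter \in S by apply: sS; rewrite inE eqxx.
have aS : forall a, hnn_incl a \in S.
  by apply: preimage_generated sA _ => x xs; apply: sS; rewrite inE xs orbT.
by elim/hnn_ind => [|a x|x|x] *; rewrite ?gpred1 ?gpredM ?gpredV.
Qed.

Section Map.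
Variables (M : groupType) (a : {multiplicative A -> M}) (z : M).
Hypothesis az : forall c, c \in C -> commute (a c) z.

Definition hnn_pair_map (x : subgroup_of C * Zgroup) : M := a (sub_incl x.1) * zpow z x.2.

Fact hnn_pair_mapM : {morph hnn_pair_map : x y / x * y}.
Proof.
move=> [c m] [d n]; rewrite /hnn_pair_map /= zpowD gmulfM -!mulgA; congr (_ * _).
by rewrite !mulgA; congr (_ * _); apply/commute_zpow/az/sub_incl_in.
Qed.
HB.instance Definition _ := isMultiplicative.Build _ M hnn_pair_map hnn_pair_mapM.

Fact hnn_map_compat c : a (sub_incl c) = hnn_pair_map (sub_pair c).
Proof. by rewrite /hnn_pair_map /= mulg1. Qed.

Lemma hnn_map : exists f : {multiplicative L -> M},
  (forall x, f (hnn_incl x) = a x) /\ f hnn_letter = z.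
Proof.
exists (amalg_map hnn_map_compat : {multiplicative _ -> _}); split=> [x|].
  exact: amalg_map_inl.
rewrite /= [LHS]amalg_map_inr /= /hnn_pair_map /= mmorph1 mul1g; exact: expg1.
Qed.
End Map.
End HNNGroup.

Section DoubleGroup.
Variables (A : groupType) (C : groupClosed A).
Local Notation L := (double_along C).

Definition double_incl (b : bool) : {multiplicative A -> L} :=
  if b then (@amalg_inl _ _ _ (@sub_incl A C) (@sub_incl A C) : {multiplicative _ -> _})
  else @amalg_inr _ _ _ (@sub_incl A C) (@sub_incl A C).

Lemma double_inclC c : c \in C -> double_incl true c = double_incl false c.
Proof. by move=> cC; exact: (amalg_glue _ _ (SubgroupOf cC)). Qed.

Lemma double_ind (P : L -> Prop) : P 1 ->
  (forall b a x, P x -> P (double_incl b a * x)) -> forall x, P x.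
Proof.
move=> P1 Pa; apply: amalg_ind => // [a x|a x]; [exact: (Pa true)|exact: (Pa false)].
Qed.

Lemma double_conjugate x :
  exists s, (exists b a, conjugate x (double_incl b a)) \/
    [/\ s != [::], cycle (double_reduced C) s &
        conjugate x (double_prod double_incl s)].
Proof.
have [s ->] : exists s, x = double_prod double_incl s.
  elim/double_ind: x => [|b a x [s ->]]; first by exists [::]; rewrite /double_prod big_nil.
  by exists ((a, b) :: s); rewrite /double_prod big_cons.
have [xa|[s' s'0 [s'c xs]]] := double_cyclic_reduction double_inclC s.
  by exists [::]; left.
by exists s'; right.
Qed.

Lemma double_finitely_generated : finitely_generated A -> finitely_generated L.
Proof.
move=> [s sA].
exists ([seq double_incl true a | a <- s] ++ [seq double_incl false a | a <- s]) => S sS.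
have aS : forall b a, double_incl b a \in S.
  move=> b; apply: preimage_generated sA _ => x xs; apply: sS; rewrite mem_cat.
  by case: b xs => ->; rewrite ?orbT.
by elim/double_ind => [|b a x] *; rewrite ?gpred1 ?gpredM.
Qed.

Lemma double_map (M : groupType) (a b : {multiplicative A -> M}) :
  (forall c, c \in C -> a c = b c) ->
  exists f : {multiplicative L -> M},
    (forall x, f (double_incl true x) = a x) /\ (forall x, f (double_incl false x) = b x).
Proof.
move=> ab; have ab' (c : subgroup_of C) : a (sub_incl c) = b (sub_incl c).
  exact/ab/sub_incl_in.
exists (amalg_map ab' : {multiplicative _ -> _}); split=> x.
  exact: amalg_map_inl.
exact: amalg_map_inr.
Qed.

End DoubleGroup.

(** * From one generic extension to a flexible family *)

Lemma multiplicative_ext (G H : groupType) (f g : {multiplicative G -> H}) :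
  f =1 g -> f = g.
Proof.
case: f g => [f [[fM]]] [g [[gM]]] /= /funext fg.
by subst g; rewrite (Prop_irrelevance fM gM).
Qed.

Lemma countableU (T : Type) (S U : set T) :
  countable S -> countable U -> countable (S `|` U).
Proof.
move=> cS cU; have -> : S `|` U = \bigcup_b (if b then S else U).
  by apply/seteqP; split=> [x [Sx|Ux]|x [[] _ ?]]; [exists true|exists false|left|right].
by apply: bigcup_countable => [|[]].
Qed.

Section Family.
Variable R : realType.

Lemma tr2J (p q : PSL2 R) : tr2 (p ^ q) = tr2 p.
Proof.
have [[M ->] [N ->]] := (PSL2P p, PSL2P q).
have -> : (\pi_(PSL2 R) M : PSL2 R) ^ (\pi_(PSL2 R) N) = \pi_(PSL2 R) (M ^ N) :> PSL2 R.
  by rewrite /conjg !piM piV.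
rewrite !tr2_pi; congr (_ ^+ 2)%R; rewrite /conjg !SL2_mulE.
rewrite [LHS]mxtrace_mulC; apply: (congr1 (@mxtrace R 2)); exact: (mulmxK (SL2_unit N)).
Qed.

Lemma tr2_1 : tr2 (1 : PSL2 R) = 4%:R%R.
Proof.
rewrite [LHS](tr2_pi (1 : SL2 R)) /= mxtrace_scalar -natrX.
by [].
Qed.

Section Extension.
Variables (A L : groupType) (iota : {multiplicative A -> L}).
Implicit Types (rho : {multiplicative A -> PSL2 R}) (sigma : {multiplicative L -> PSL2 R}).

(** Up to conjugacy, the trace of x either comes from A or avoids T. The condition
    on exponents transports torsion from a to x and, for n = 1, triviality. *)
Definition generic_extension rho sigma (T : set R) :=
  (forall a, sigma (iota a) = rho a) /\
  forall x, (exists a g, sigma x = rho a ^ g /\ forall n, a ^+ n = 1 -> x ^+ n = 1) \/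
    ~ T (tr2 (sigma x)).

Lemma generic_extensionS rho sigma (S T : set R) :
  S `<=` T -> generic_extension rho sigma T -> generic_extension rho sigma S.
Proof.
by move=> ST [e g]; split=> // x; case: (g x) => [|nT]; [left|right=> /ST].
Qed.

Lemma generic_extension_faithful rho sigma :
  generic_extension rho sigma [set 4%:R%R] -> faithful rho -> faithful sigma.
Proof.
move=> [_ gen] rho_inj x y xy; apply/divg1_eq.
have s1 : sigma (x / y) = 1 by rewrite gmulfM mmorphV xy mulgV.
case: (gen (x / y)) => [[a [g []]]|]; last by rewrite s1 tr2_1; case.
rewrite s1 => /esym/eqP; rewrite conjg_eq1 => /eqP ra /(_ 1%N); rewrite !expg1; apply.
by apply: rho_inj; rewrite ra mmorph1.
Qed.

Lemma generic_extension_parabolic_free rho sigma :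
  generic_extension rho sigma [set 4%:R%R] -> parabolic_free rho -> parabolic_free sigma.
Proof.
move=> [_ gen] pf x [n1 t4]; case: (gen x) => [[a [g [sx _]]]|[]//].
by apply: (pf a); split; [move=> r1; apply: n1; rewrite sx r1 conj1g|rewrite -t4 sx tr2J].
Qed.

Lemma generic_extension_indiscrete rho sigma (T : set R) :
  generic_extension rho sigma T -> indiscrete rho -> indiscrete sigma.
Proof.
move=> [ext _] indis dis; apply: indis => _ [a _ <-].
have [_ [V nV VE]] : isolated (range sigma) (rho a) by apply: dis; exists (iota a).
split; first by apply/mem_set; exists a.
exists V => //; apply/seteqP; split=> [p [Vp [b _ pE]]|p ->].
  by rewrite -VE; split=> //; exists (iota b) => //; rewrite ext.
by split; [exact: nbhs_singleton|exists a].
Qed.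

Hypothesis countable_L : countable [set: L].
Variable Lambda : set {multiplicative A -> PSL2 R}.
Hypothesis Lambda_flexible : flexible_family Lambda.
Hypothesis extends : forall rho T, Lambda rho -> countable T ->
  exists2 sigma, generic_extension rho sigma T & (liftable rho -> liftable sigma).

(** A maximal tracially disjoint set of generic extensions is uncountable:
    given countably many extensions, only countably many members of the family
    share a trace with them, and any other member has an extension avoiding the
    countably many traces already taken. *)
Lemma flexible_family_extension : exists Sigma : set {multiplicative L -> PSL2 R},
  flexible_family Sigma /\
  ((forall rho, Lambda rho -> liftable rho) -> forall sigma, Sigma sigma -> liftable sigma).
Proof.
have [nc tdisj Lam] := Lambda_flexible.
pose good sigma := exists2 rho, Lambda rho &
  generic_extension rho sigma [set 4%:R%R] /\ (liftable rho -> liftable sigma).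
pose P (X : set {multiplicative L -> PSL2 R}) := X `<=` good /\ tracially_disjoint X.
have [F FP Ftot|X [[Xgood Xdisj] Xmax]] := @Zorn_bigcup _ P.
  split=> [x [X /FP[Xg _] /Xg//]|x y [X FX Xx] [Y FY Yy]].
  by have [XY|YX] := Ftot _ _ FX FY; [have [_] := FP _ FY|have [_] := FP _ FX]; apply => //;
    [exact: XY|exact: YX].
exists X; split; last first.
  by move=> lift s /Xgood[rho Lrho [_]]; apply; exact: lift.
split=> // [cX|s /Xgood[rho /Lam[ind fai par] [gen _]]]; last first.
  split; [exact: generic_extension_indiscrete gen ind
         |exact: generic_extension_faithful gen fai
         |exact: generic_extension_parabolic_free gen par].
pose T := [set 4%:R%R] `|` \bigcup_(s in X) range (fun x => tr2 (s x)).
have cT : countable T.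
  apply: countableU; first exact: countable1.
  by apply: bigcup_countable => // s _; apply: sub_countable (card_image_le _ _) countable_L.
(* U are the members already extended, V those sharing a trace with T. *)
pose U := [set (s \o iota : {multiplicative A -> PSL2 R}) | s in X].
have cU : countable U by apply: sub_countable (card_image_le _ _) cX.
pose hits v rho := Lambda rho /\ exists2 a, (~` torsion A) a & tr2 (rho a) = v.
pose V := \bigcup_(v in T) hits v.
have cV : countable V.
  apply: bigcup_countable => // v _; apply: finite_set_countable.
  have [[rho [Lrho [a na av]]]|none] := pselect (exists rho, hits v rho).
    apply: (@sub_finite_set _ _ [set rho]); last exact: finite_set1.
    move=> mu [Lmu [b nb bv]] /=; apply: contrapT => ne.
    have : ([set tr2 (mu g) | g in ~` torsion A] `&`
            [set tr2 (rho g) | g in ~` torsion A]) v.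
      by split; [exists b|exists a].
    by rewrite tdisj.
  by apply: (@sub_finite_set _ _ set0) => // mu h; apply: none; exists mu.
have [rho Lrho nUV] : exists2 rho, Lambda rho & ~ (U `|` V) rho.
  apply: contrapT => none; apply: nc; apply: (@sub_countable _ _ _ (U `|` V)).
    apply: subset_card_le => rho Lrho; apply: contrapT => nUV; apply: none; by exists rho.
  exact: countableU.
have [s gen lift] := extends Lrho cT.
have sV x : (~` torsion L) x -> ~ T (tr2 (s x)).
  move=> nx Tx; have [ext] := gen => /(_ x)[[a [g [sx an]]]|//].
  apply: nUV; right; exists (tr2 (s x)) => //; split=> //; exists a; last by rewrite sx tr2J.
  by move=> [n n0 /an xn]; apply: nx; exists n.
apply: (Xmax (X `|` [set s])).
  split; first by move=> x; left.
  move=> /(_ s (or_intror erefl)) Xs; apply: nUV; left; exists s => //.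
  by apply: multiplicative_ext => a /=; rewrite gen.1.
have sX t : X t -> [set tr2 (s g) | g in ~` torsion L] `&`
                   [set tr2 (t g) | g in ~` torsion L] = set0.
  move=> Xt; rewrite -subset0 => v [[x nx <-] [y ny yx]].
  by apply: (sV x nx); right; exists t => //; exists y.
split=> [t [/Xgood//|->]|t1 t2 [X1|->] [X2|->] ne].
- exists rho => //; split=> //; apply: generic_extensionS gen => v; exact: or_introl.
- exact: Xdisj.
- by rewrite setIC sX.
- exact: sX.
- by case: ne.
Qed.

End Extension.

Lemma flexible_extension (A L : groupType) (iota : {multiplicative A -> L}) :
  (finitely_generated A -> finitely_generated L) ->
  (finitely_generated A -> forall (rho : {multiplicative A -> PSL2 R}) T,
    faithful rho -> parabolic_free rho -> countable T ->
    exists2 sigma, generic_extension iota rho sigma T & (liftable rho -> liftable sigma)) ->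
  (flexible R A -> flexible R L) /\ (liftable_flexible R A -> liftable_flexible R L).
Proof.
move=> fgL ext; split.
  move=> [fgA [Lam flex]]; split; first exact: fgL.
  have [|rho T Lrho cT|Sig [? _]] := @flexible_family_extension A L iota _ Lam flex.
  - exact/finitely_generated_countable/fgL.
  - have [_ _ /(_ _ Lrho)[_ fai pf]] := flex; exact: ext.
  - by exists Sig.
move=> [fgA [Lam [flex lif]]]; split; first exact: fgL.
have [|rho T Lrho cT|Sig [? lif']] := @flexible_family_extension A L iota _ Lam flex.
- exact/finitely_generated_countable/fgL.
- have [_ _ /(_ _ Lrho)[_ fai pf]] := flex; exact: ext.
- by exists Sig; split=> //; exact: lif'.
Qed.
End Family.

(** * Lifting to the universal cover *)

Section Lifting.
Variable R : realType.
Implicit Types (J : 'M[R]_2) (u : R).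
Local Open Scope ring_scope.

Lemma continuous_axis_elt J (tJ : \tr J = 0) : continuous (axis_elt tJ).
Proof.
apply: continuous_SL2; apply: continuous_mx => i j.
pose e : {poly R} := 1 + (1 + \det J ^+ 2) *: 'X^2.
pose d : {poly R} := e ^+ 2 + \det J *: 'X^2.
have eE u : axis_re J u = e.[u] by rewrite /e !hornerE /axis_re /=; ring.
have dE u : axis_norm J u = d.[u].
  by rewrite /d hornerD horner_exp hornerZ hornerXn -eE.
rewrite (_ : (fun _ => _) = fun u => (Num.sqrt d.[u])^-1 *
    (e *+ (i == j) + J i j *: 'X).[u]).
  move=> u; apply: cvgM; last exact: continuous_horner.
  apply: cvgV; first by rewrite sqrtr_eq0 -ltNge -dE axis_norm_gt0.
  apply: (@continuous_comp _ _ _ (horner d) (@Num.sqrt R)); first exact: continuous_horner.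
  exact: sqrt_continuous.
apply/funext => u; rewrite /= /axis_mx !mxE dE eE [(e *+ _ + _).[u]]hornerD.
by rewrite hornerMn hornerZ hornerX [u * _]mulrC.
Qed.

Definition axis_pelt J (tJ : \tr J = 0) u : PSL2 R := \pi_(PSL2 R) (axis_elt tJ u).

Lemma continuous_axis_pelt J (tJ : \tr J = 0) : continuous (axis_pelt tJ).
Proof.
move=> u; apply: (@continuous_comp _ _ _ (axis_elt tJ) (\pi_(PSL2 R))).
  exact: continuous_axis_elt.
exact: PSL2_pi_continuous.
Qed.

Lemma continuous_axis_comp J (tJ : \tr J = 0) (X : topologicalType) (f : X -> R) :
  continuous f -> continuous (fun x => axis_pelt tJ (f x)).
Proof.
move=> fc x.
exact: (cvg_comp f (axis_pelt tJ) (fc x) (@continuous_axis_pelt J tJ (f x))).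
Qed.

Lemma axis_pelt0 J (tJ : \tr J = 0) : axis_pelt tJ 0 = 1%g.
Proof. by rewrite /axis_pelt axis_elt0. Qed.

Fact axis_path_proof J (tJ : \tr J = 0) u :
  `[< based_path (fun t => axis_pelt tJ (t * u)) >].
Proof.
apply/asboolP; split; last by rewrite mul0r axis_pelt0.
by apply/continuous_subspaceT/continuous_axis_comp; exact: mulrr_continuous.
Qed.

Definition axis_path J (tJ : \tr J = 0) u : pathPSL2 R := MkPath (axis_path_proof tJ u).

Definition axis_lift J (tJ : \tr J = 0) u : uPSL2 R := \pi_(uPSL2 R) (axis_path tJ u).

Lemma covering_axis_lift J (tJ : \tr J = 0) u :
  covering_map (axis_lift tJ u) = axis_pelt tJ u.
Proof. by rewrite covering_map_pi /= mul1r. Qed.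

(** Conjugating a path by the path of the axis up to time v, with v going from
    0 to 1, is a homotopy whose endpoint does not move. *)
Lemma axis_lift_commute J (tJ : \tr J = 0) u (x : uPSL2 R) :
  (forall v, commute (axis_pelt tJ v) (covering_map x)) -> commute x (axis_lift tJ u).
Proof.
have [c ->] := uPSL2P x; rewrite covering_map_pi => com.
rewrite /commute /axis_lift [LHS]uPSL2_mul_pi [RHS]uPSL2_mul_pi; apply/uPSL2_eqP.
have [cc c0] := based_pathP c.
pose z := axis_pelt tJ.
pose w (y : R * R) := z (y.1 * y.2 * u).
exists (fun y : R * R => w y * c y.1 * (w y)^-1 * z (y.1 * u)%R)%g.
split.
- have zc : continuous (fun y : R * R => z (y.1 * y.2 * u)).
    apply: continuous_axis_comp => y.
    by apply: cvgMl; apply: cvgM; [exact: cvg_fst|exact: cvg_snd].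
  have zc1 : continuous (fun y : R * R => z (y.1 * u)).
    by apply: continuous_axis_comp => y; apply: cvgMl; exact: cvg_fst.
  apply: continuous_mulPSL2; last exact: continuous_subspaceT.
  apply: continuous_mulPSL2; last by apply: continuous_invPSL2; exact: continuous_subspaceT.
  apply: continuous_mulPSL2; first exact: continuous_subspaceT.
  exact: square_fst_continuous.
- by move=> t _; rewrite /w /= mulr0 mul0r /z axis_pelt0 invg1 mulg1 mul1g.
- by move=> t _; rewrite /w /= mulr1 mulgVK.
- by move=> v _; rewrite /w /= !mul0r c0 /z axis_pelt0 !mulg1 invg1 mulg1.
- by move=> v _; rewrite /w /= !mul1r com mulgK.
Qed.

End Lifting.

(** * Generic extensions of a representation *)

Section Extensions.
Variables (R : realType) (A : groupType) (C : groupClosed A).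
Variables (rho : {multiplicative A -> PSL2 R}) (J : 'M[R]_2).
Hypothesis axisJ : is_axis C rho J.
Let tJ : (\tr J = 0)%R. Proof. by case: axisJ. Qed.

Definition lift_word (s : seq (A * bool)) : seq (SL2 R * bool) :=
  [seq (repr (rho x.1), x.2) | x <- s].

Let matrix_word (s : seq (A * bool)) : seq ('M[R]_2 * bool) :=
  [seq (SL2_mx x.1, x.2) | x <- lift_word s].

Lemma pi_axis_word u s : \pi_(PSL2 R) (axis_word tJ u (lift_word s)) =
  \prod_(x <- s) (rho x.1 * if x.2 then axis_pelt tJ u else (axis_pelt tJ u)^-1) :> PSL2 R.
Proof.
rewrite /axis_word big_map; elim: s => [|[a b] s IH]; first by rewrite !big_nil.
by rewrite !big_cons piM IH piM rho_pmx; case: b; rewrite //= piV.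
Qed.

Lemma axis_pelt_commute c v : c \in C -> commute (axis_pelt tJ v) (rho c).
Proof.
case: axisJ => _ _ comm _ /comm Jc; rewrite -[rho c]rho_pmx /commute /axis_pelt -!piM.
by congr (\pi_(PSL2 R) _); apply: commute_axis_elt.
Qed.

(** Between equal exponents a letter of C is allowed: it commutes with J, so its
    diagonal entries in an eigenbasis of J are its nonzero eigenvalues. *)
Lemma hnn_reduced_transverse s : cycle (hnn_reduced C) s ->
  cycle (transverse J) (matrix_word s).
Proof.
case: axisJ => _ dJ comm trans; rewrite /matrix_word /lift_word -map_comp cycle_map.
apply: sub_cycle => -[a e] [b e']; rewrite /hnn_reduced /transverse /=.
have [bC /= /eqP->|/trans[] ] := boolP (b \in C); last by case: ifP.
have d0 : (pmx (rho b) * J - J * pmx (rho b) = 0)%R by rewrite comm// subrr.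
rewrite eqxx; have := axis_form_commutator tJ (SL2_det (repr (rho b))).
rewrite -/(pmx (rho b)) d0.
rewrite det0 => /eqP; rewrite addr_eq0 => /eqP ->.
by rewrite oppr_eq0 mulf_neq0// pnatr_eq0.
Qed.

(** The letters of a reduced cyclic word of the double lie outside C, hence satisfy
    both nonvanishing conditions of an axis, whatever the exponents. *)
Lemma double_reduced_transverse s : cycle (double_reduced C) s ->
  cycle (transverse J) (matrix_word s).
Proof.
move=> cs; apply: hnn_reduced_transverse; apply: sub_cycle cs => x y.
by rewrite /double_reduced /hnn_reduced => /andP[_ /negPf ->].
Qed.

(** Each word and each value exclude finitely many parameters. *)
Lemma generic_parameter (L : Type) (s : L -> seq (A * bool)) (T : set R) :
  countable [set: L] -> countable T ->
  exists u, forall x, s x != [::] -> cycle (transverse J) (matrix_word (s x)) ->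
    ~ T (tr2 (\pi_(PSL2 R) (axis_word tJ u (lift_word (s x))))).
Proof.
move=> cL cT; case: axisJ => _ dJ _ _.
pose bad x := if (s x != [::]) && cycle (transverse J) (matrix_word (s x))
  then \bigcup_(v in T)
    [set u | (\tr (SL2_mx (axis_word tJ u (lift_word (s x)))) ^+ 2 = v)%R]
  else set0.
have /ex_not_countable[u _ ub] : countable (\bigcup_(x in [set: L]) bad x).
  apply: bigcup_countable => // x _; rewrite /bad.
  case: ifP => [/andP[sn cs]|_]; last exact: countable0.
  apply: bigcup_countable => // v _; apply: finite_set_countable.
  by apply: axis_word_tr2_finite => //; case: (s x) sn.
exists u => x sn cs Tx; apply: ub; exists x => //; rewrite /bad sn cs /=.
by exists (tr2 (\pi_(PSL2 R) (axis_word tJ u (lift_word (s x))))) => //=; rewrite tr2_pi.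
Qed.

Lemma conjugate_image (L : groupType) (sigma : {multiplicative L -> PSL2 R})
    (iota : {multiplicative A -> L}) x a g :
  conjugate x (iota a) -> sigma (iota a) = rho a ^ g ->
  exists a g, sigma x = rho a ^ g /\ forall n, a ^+ n = 1 -> x ^+ n = 1.
Proof.
move=> [h xh] sa; exists a, (g * (sigma h)^-1); split.
  by rewrite conjgM -sa -xh mmorphJ conjgK.
move=> n an; apply/eqP; rewrite -(conjg_eq1 _ h) conjXg xh -mmorphX an.
by rewrite mmorph1.
Qed.

Lemma tr2_conjugate (L : groupType) (sigma : {multiplicative L -> PSL2 R}) x y :
  conjugate x y -> tr2 (sigma x) = tr2 (sigma y).
Proof. by move=> [h <-]; rewrite mmorphJ tr2J. Qed.

(** The stable letter is sent to a generic point z of the centraliser of C. *)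
Lemma hnn_extension (T : set R) : countable [set: HNN_along C] -> countable T ->
  exists2 sigma, generic_extension (hnn_incl C) rho sigma T & (liftable rho -> liftable sigma).
Proof.
move=> cL cT.
have [s sP] := choice (@hnn_conjugate A C).
have [u uT] := generic_parameter s cL cT; pose z := axis_pelt tJ u.
have zC c : c \in C -> commute (rho c) z.
  by move=> cC; exact/commute_sym/axis_pelt_commute.
have [sigma [sa st]] := hnn_map zC.
exists sigma.
  split=> // x; have [[a xa]|[s0 cs xs]] := sP x; [left|right].
    by apply: (conjugate_image (g := 1) xa); rewrite sa conjg1.
  rewrite (tr2_conjugate sigma xs).
  rewrite (_ : sigma _ = \pi_(PSL2 R) (axis_word tJ u (lift_word (s x)))).
    by apply: uT => //; exact: hnn_reduced_transverse.
  rewrite pi_axis_word /hnn_prod; elim: (s x) => [|[a b] t IH]; first by rewrite !big_nil mmorph1.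
  by rewrite !big_cons gmulfM IH gmulfM sa; case: b; rewrite /= ?mmorphV st.
move=> [lift liftE].
have com c : c \in C -> commute (lift c) (axis_lift tJ u).
  by move=> cC; apply: axis_lift_commute => v; rewrite -liftE; exact: axis_pelt_commute.
have [lsigma [la lt]] := hnn_map com.
exists lsigma; elim/hnn_ind => [|a x IH|x IH|x IH].
- by rewrite !mmorph1.
- by rewrite !gmulfM IH sa la liftE.
- by rewrite !gmulfM IH st lt /= covering_axis_lift.
- by rewrite !gmulfM IH !mmorphV st lt /= covering_axis_lift.
Qed.

Section Conjugation.
Variables (M : groupType) (a : {multiplicative A -> M}) (z : M).
Definition conj_morph (x : A) : M := a x ^ z^-1.
Fact conj_morphM : {morph conj_morph : x y / x * y}.
Proof. by move=> x y; rewrite /conj_morph gmulfM conjMg. Qed.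
HB.instance Definition _ := isMultiplicative.Build A M conj_morph conj_morphM.
End Conjugation.

(** In an alternating word the conjugators of consecutive letters combine into
    single powers of z, as in the HNN extension. *)
Lemma alternating_prod (M : groupType) (a : {multiplicative A -> M}) (z : M) x s :
  path (fun x y : A * bool => x.2 != y.2) x s ->
  let w b := if b then 1 else z in
  \prod_(y <- x :: s) (w y.2 * a y.1 * (w y.2)^-1) =
  w x.2 * \prod_(y <- x :: s) (a y.1 * if y.2 then z else z^-1) * (w (~~ (last x s).2))^-1.
Proof.
move=> ps w; have wN b : (if b then z else z^-1) * (w (~~ b))^-1 = (w b)^-1.
  by case: b; rewrite /w /= ?mulgV ?invg1 ?mulg1.
elim: s x ps => [|y s IH] x /=; first by rewrite !big_seq1 -!mulgA wN.
move=> /andP[xy /IH /= sE]; rewrite big_cons sE [in RHS]big_cons !mulgA -wN.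
have -> : y.2 = ~~ x.2 by case: x.2 (y.2) xy => -[].
by rewrite -!mulgA mulKg.
Qed.

(** The second copy of A is represented by the conjugate of rho by a generic point z
    of the centraliser of C, which does not change rho on C. *)
Lemma double_extension (T : set R) : countable [set: double_along C] -> countable T ->
  exists2 sigma, generic_extension (double_incl C true) rho sigma T &
    (liftable rho -> liftable sigma).
Proof.
move=> cL cT.
have [s sP] := choice (@double_conjugate A C).
have [u uT] := generic_parameter s cL cT; pose z := axis_pelt tJ u.
have compat (M : groupType) (a : {multiplicative A -> M}) y :
    (forall c, c \in C -> commute (a c) y) -> forall c, c \in C -> a c = conj_morph a y c.
  move=> ay c /ay cy; apply/esym/conjg_fixP/commgP/commuteV; exact: cy.
have zC c : c \in C -> commute (rho c) z.
  by move=> cC; exact/commute_sym/axis_pelt_commute.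
have [sigma [st sf]] := double_map (compat _ rho z zC).
exists sigma.
  split=> // x; have [[b [a xa]]|[s0 cs xs]] := sP x; [left|right].
    apply: (conjugate_image (g := if b then 1 else z^-1) xa).
    by case: b {xa}; rewrite ?st ?sf ?conjg1.
  rewrite (tr2_conjugate sigma xs).
  have tw : ~ T (tr2 (\pi_(PSL2 R) (axis_word tJ u (lift_word (s x))))).
    by apply: uT => //; exact: double_reduced_transverse.
  set W : PSL2 R := \pi_(PSL2 R) _ in tw.
  suff [h <-] : conjugate W (sigma (double_prod (double_incl C) (s x))) by rewrite tr2J.
  rewrite /W {W tw}.
  rewrite pi_axis_word -/z; case: (s x) s0 cs {xs} => // y t _ cs.
  have alt : cycle (fun x y : A * bool => x.2 != y.2) (y :: t).
    by apply: sub_cycle cs => ? ? /andP[].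
  have -> : sigma (double_prod (double_incl C) (y :: t)) =
      \prod_(x <- y :: t) ((if x.2 then 1 else z) * rho x.1 * (if x.2 then 1 else z)^-1).
    rewrite /double_prod; elim: (y :: t) => [|[a b] r IH]; first by rewrite !big_nil mmorph1.
    rewrite !big_cons gmulfM IH; congr (_ * _); case: b => /=.
      by rewrite st invg1 mulg1 mul1g.
    by rewrite sf /= /conj_morph /conjg invgK mulgA.
  have := alt; rewrite /= rcons_path => /andP[pt lt].
  rewrite (alternating_prod rho z pt) /=.
  have -> : ~~ (last y t).2 = y.2 by case: (last y t).2 (y.2) lt => -[].
  exists (if y.2 then 1 else z)^-1; by rewrite /conjg invgK mulgA.
move=> [lift liftE].
have com c : c \in C -> commute (lift c) (axis_lift tJ u).
  by move=> cC; apply: axis_lift_commute => v; rewrite -liftE; exact: axis_pelt_commute.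
have [lsigma [lt lf]] := double_map (compat _ lift _ com).
exists lsigma; elim/double_ind => [|b a x IH]; first by rewrite !mmorph1.
rewrite !gmulfM IH; congr (_ * _); case: b; first by rewrite st lt liftE.
rewrite sf lf /= /conj_morph /conjg !gmulfM !mmorphV !invgK liftE /= covering_axis_lift.
by [].
Qed.

End Extensions.

Theorem corollary1p6 (R : realType) (A : groupType) (C : groupClosed A) :
  abelian_subgroup C -> malnormal C ->
  (flexible R A -> flexible R (HNN_along C) /\ flexible R (double_along C)) /\
  (liftable_flexible R A ->
     liftable_flexible R (HNN_along C) /\ liftable_flexible R (double_along C)).
Proof.
move=> abC mC.
have axis (rho : {multiplicative A -> PSL2 R}) : finitely_generated A ->
    faithful rho -> parabolic_free rho -> exists J, is_axis C rho J.
  by move=> /finitely_generated_countable cA inj pf; exact: axis_exists.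
have [hf hl] : (flexible R A -> flexible R (HNN_along C)) /\
    (liftable_flexible R A -> liftable_flexible R (HNN_along C)).
  apply: (flexible_extension (iota := hnn_incl C)); first exact: hnn_finitely_generated.
  move=> fgA rho T inj pf cT; have [J aJ] := axis rho fgA inj pf.
  apply: (hnn_extension aJ) => //.
  exact/finitely_generated_countable/hnn_finitely_generated.
have [df dl] : (flexible R A -> flexible R (double_along C)) /\
    (liftable_flexible R A -> liftable_flexible R (double_along C)).
  apply: (flexible_extension (iota := double_incl C true)).
    exact: double_finitely_generated.
  move=> fgA rho T inj pf cT; have [J aJ] := axis rho fgA inj pf.
  apply: (double_extension aJ) => //.
  exact/finitely_generated_countable/double_finitely_generated.
by split=> h; split; [exact: hf|exact: df|exact: hl|exact: dl].
Qed.
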